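(* There is an algorithm which, given any set $S$ of $n$ points in $\mathbb{R}^2$, computes a dominating set $S'\subseteq S$ of $S$ with $|S'|\le 4\,|OPT|$, where $OPT$ is a minimum dominating set of $S$, and which runs in $O(n^{6}\log n)$ time.
   Context: For a finite point set $S\subset\mathbb{R}^2$, a dominating set of $S$ is a subset $S'\subseteq S$ such that every point of $S$ lies in (is covered by) at least one disk of radius $1$ centered at a point of $S'$, i.e. every point of $S$ is at Euclidean distance at most $1$ from some point of $S'$. A minimum dominating set (MDS) is a dominating set of minimum cardinality. A $c$-factor approximation algorithm for the MDS problem outputs a dominating set of size at most $c$ times the size of a minimum dominating set. *)

(* Defs.v *)
From HB Require Import structures.
From mathcomp Require Import all_boot all_order all_algebra finmap.
From mathcomp Require Import reals exp.

Set Implicit Arguments.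
Unset Strict Implicit.
Unset Printing Implicit Defensive.

Import Order.TTheory GRing.Theory Num.Theory.
Local Open Scope fset_scope.
Local Open Scope ring_scope.

Section Domination.
Variable R : realType.

(* The library norm on [R * R] is the sup norm, so the Euclidean distance is
   written out. *)
Definition edist (p q : R * R) : R :=
  Num.sqrt ((p.1 - q.1) ^+ 2 + (p.2 - q.2) ^+ 2).

Definition dominating (S S' : {fset R * R}) : Prop :=
  S' `<=` S /\ forall p, p \in S -> exists2 q, q \in S' & edist p q <= 1.

Definition min_dominating (S D : {fset R * R}) : Prop :=
  dominating S D /\ forall D', dominating S D' -> (#|` D| <= #|` D'|)%N.

End Domination.

(* The model of computation is the real RAM: a random-access machine whose
   memory consists of exact real numbers and of integer words of [w] bits.
   Programs are while-programs over unboundedly long arrays of words and of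
   reals, indexed by words; the arrays are named by numerals in the program
   text, so that a program uses finitely many of them.  Real numbers support
   unit-cost field operations, square roots and comparisons, but there is no
   way to round a real to a word, and program texts contain no real
   constants. *)

Inductive wop := WAdd | WSub | WMul | WDiv | WMod.
Inductive rop := RAdd | RSub | RMul | RDiv.

Inductive wexp :=
| WConst of nat
| WGet of nat & wexp
| WOp of wop & wexp & wexp.

Inductive rexp :=
| RCast of wexp
| RGet of nat & wexp
| ROp of rop & rexp & rexp
| RSqrt of rexp.

Inductive bexp :=
| WLt of wexp & wexp
| RLt of rexp & rexp
| BNot of bexp
| BAnd of bexp & bexp.

Inductive cmd :=
| Skip
| WSet of nat & wexp & wexp
| RSet of nat & wexp & rexp
| Seq of cmd & cmd
| If of bexp & cmd & cmd
| While of bexp & cmd.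

(* Evaluating an expression costs one step per node. *)
Fixpoint wcost (e : wexp) : nat :=
  match e with
  | WConst _ => 1
  | WGet _ i => (wcost i).+1
  | WOp _ e1 e2 => (wcost e1 + wcost e2).+1
  end.

Fixpoint rcost (e : rexp) : nat :=
  match e with
  | RCast i => (wcost i).+1
  | RGet _ i => (wcost i).+1
  | ROp _ e1 e2 => (rcost e1 + rcost e2).+1
  | RSqrt e1 => (rcost e1).+1
  end.

Fixpoint bcost (b : bexp) : nat :=
  match b with
  | WLt e1 e2 => (wcost e1 + wcost e2).+1
  | RLt e1 e2 => (rcost e1 + rcost e2).+1
  | BNot b1 => (bcost b1).+1
  | BAnd b1 b2 => (bcost b1 + bcost b2).+1
  end.

Definition upd (T : Type) (m : nat -> nat -> T) (a i : nat) (v : T) :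
    nat -> nat -> T :=
  fun a' i' => if (a' == a) && (i' == i) then v else m a' i'.

Section RealRAM.
Variable R : realType.

(* [wmem st a i] is cell [i] of the word array [a]; similarly for [rmem]. *)
Record state := State { wmem : nat -> nat -> nat; rmem : nat -> nat -> R }.

Definition set_w (st : state) (a i v : nat) : state :=
  State (upd (wmem st) a i v) (rmem st).

Definition set_r (st : state) (a i : nat) (v : R) : state :=
  State (wmem st) (upd (rmem st) a i v).

(* Subtraction of words is truncated at 0, and quotients by 0 are 0. *)
Definition wop_sem (o : wop) : nat -> nat -> nat :=
  match o with
  | WAdd => addn | WSub => subn | WMul => muln | WDiv => divn | WMod => modn
  end.

Definition rop_sem (o : rop) (x y : R) : R :=
  match o with
  | RAdd => x + y | RSub => x - y | RMul => x * y | RDiv => x / y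
  end.

Section Run.
Variable w : nat.

(* Every computed word is reduced modulo [2 ^ w]. *)
Fixpoint weval (st : state) (e : wexp) : nat :=
  match e with
  | WConst c => c %% 2 ^ w
  | WGet a i => wmem st a (weval st i)
  | WOp o e1 e2 => wop_sem o (weval st e1) (weval st e2) %% 2 ^ w
  end.

Fixpoint reval (st : state) (e : rexp) : R :=
  match e with
  | RCast i => (weval st i)%:R
  | RGet a i => rmem st a (weval st i)
  | ROp o e1 e2 => rop_sem o (reval st e1) (reval st e2)
  | RSqrt e1 => Num.sqrt (reval st e1)
  end.

Fixpoint beval (st : state) (b : bexp) : bool :=
  match b with
  | WLt e1 e2 => (weval st e1 < weval st e2)%N
  | RLt e1 e2 => reval st e1 < reval st e2
  | BNot b1 => ~~ beval st b1
  | BAnd b1 b2 => beval st b1 && beval st b2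
  end.

(* [exec P st t st'] : started in [st], the program [P] halts in [st'] after
   exactly [t] steps. *)
Inductive exec : cmd -> state -> nat -> state -> Prop :=
| exec_Skip st : exec Skip st 1 st
| exec_WSet a i e st :
    exec (WSet a i e) st (wcost i + wcost e).+1
      (set_w st a (weval st i) (weval st e))
| exec_RSet a i e st :
    exec (RSet a i e) st (wcost i + rcost e).+1
      (set_r st a (weval st i) (reval st e))
| exec_Seq P1 P2 st st1 st2 t1 t2 :
    exec P1 st t1 st1 -> exec P2 st1 t2 st2 ->
    exec (Seq P1 P2) st (t1 + t2) st2
| exec_If b P1 P2 st st' t :
    exec (if beval st b then P1 else P2) st t st' ->
    exec (If b P1 P2) st (bcost b + t).+1 st'
| exec_WhileF b P st :
    ~~ beval st b -> exec (While b P) st (bcost b).+1 st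
| exec_WhileT b P st st1 st2 t1 t2 :
    beval st b -> exec P st t1 st1 -> exec (While b P) st1 t2 st2 ->
    exec (While b P) st (bcost b + t1 + t2).+1 st2.

Lemma exec_det P st t1 st1 t2 st2 :
  exec P st t1 st1 -> exec P st t2 st2 -> t1 = t2 /\ st1 = st2.
Proof.
move=> H; elim: H t2 st2 => {P st t1 st1}
  [st|a i e st|a i e st|P1 P2 st s1 s2 u1 u2 _ IH1 _ IH2|b P1 P2 st s1 u1 _ IH
  |b P st nb|b P st s1 s2 u1 u2 hb _ IH1 _ IH2] t' st' H;
  inversion H as [| | |? ? ? s1' ? ? ? E1 E2|? ? ? ? ? ? E
    |? ? ? nb'|? ? ? s1' ? ? ? hb' E1 E2]; subst=> //.
- by case: (IH1 _ _ E1) => -> E; subst; case: (IH2 _ _ E2) => -> ->.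
- by case: (IH _ _ E) => -> ->.
- by rewrite hb' in nb.
- by rewrite hb in nb'.
- by case: (IH1 _ _ E1) => -> E; subst; case: (IH2 _ _ E2) => -> ->.
Qed.

End Run.

(* A sequence of points is stored as its length in cell 0 of the word array 0,
   followed by its abscissae in the real array 0 and its ordinates in the real
   array 1; inputs and outputs use the same format.  All other input cells
   contain 0. *)
Definition input (s : seq (R * R)) : state :=
  State (fun a i => if (a == 0) && (i == 0) then size s else 0)%N
        (fun a i => match a with
                    | 0%N => (nth (0, 0) s i).1
                    | 1%N => (nth (0, 0) s i).2
                    | _ => 0
                    end).

Definition output (st : state) : seq (R * R) :=
  [seq (rmem st 0 i, rmem st 1 i) | i <- iota 0 (wmem st 0 0)].

End RealRAM.

(* Words of [k * ceil (log2 (n + 2))] bits, i.e. of O(log n) bits. *)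
Definition word_size (k n : nat) : nat := (k * up_log 2 n.+2)%N.

(* Main.v *)
Require Import Defs.
From HB Require Import structures.
From mathcomp Require Import all_boot all_order all_algebra finmap.
From mathcomp Require Import reals exp zify ring lra.

(* The points are cut from bottom to top into rows of height at most 2/3, each
   row starting at the lowest point that remains.  A unit disk meets at most
   four rows, so it suffices to solve every row exactly: the optima of the rows
   add up to at most 4 |OPT|.

   Sort a row by abscissa and assign to each point a disk that contains it.  Call
   a disk active at a gap between consecutive points if it serves points on both
   sides of the gap.  If six disks are active at a gap, the points they serve
   span a width of at most 4, hence split into six consecutive blocks of size at
   most 2/3 by 2/3, and each block is dominated by any one of its points.
   Exchanging the six disks for these six points costs nothing and shortens the
   assignment.  So some optimal assignment has at most five active disks at every
   gap, and a dynamic program over the O(n^5) sets of held disks finds the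
   optimum.  All rows are processed in one pass, which takes O(n^6) steps. *)

Set Implicit Arguments.
Unset Strict Implicit.
Unset Printing Implicit Defensive.

(** * Assignments with few active labels *)

(** The height 2/3 fits two bounds at once. A square of side 2/3 has diameter below 1, so any of its
    points dominates it. Row starts differ by more than 2/3, so rows whose numbers differ by at
    least 4 have no two points with ordinates within 2 of each other. The points served by disks
    active at a gap lie within 2 of one abscissa, and 4 is six times 2/3: hence six blocks and five
    held disks.

    A label is a pair of a row and a disk. A disk that serves four rows thus counts four times, and
    no label is active between two rows, which makes a single pass over all rows sound.

    A cell of the table is a number of remaining points together with five disks, so there are
    (n+1)^6 cells and each may be involved in boundedly many steps only. Choosing the disk to buy at
    a cell would cost another factor n. Instead, the cell reached by a purchase pushes its value to
    the cell where the purchase is made, which is found by erasing one digit; every cell then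
    handles at most sixteen edges. *)

Section Depth.
Variables (n m : nat) (L : finType) (ok : 'I_n -> L -> Prop).
Implicit Types a : 'I_n -> L.

(* Gap [g] separates the indices [i < g] from the indices [i >= g]. *)
Definition before a g : {set L} := [set a i | i : 'I_n & i < g].
Definition after a g : {set L} := [set a i | i : 'I_n & g <= i].
Definition active a g : {set L} := before a g :&: after a g.
Definition labels a : {set L} := [set a i | i : 'I_n].

Lemma activeP a g l :
  reflect (exists i j : 'I_n, [/\ i < g, g <= j, a i = l & a j = l])
          (l \in active a g).
Proof.
apply: (iffP setIP) => [[/imsetP[i + ->] /imsetP[j + e]]|[i [j [ig gj <- e]]]].
  by rewrite !inE => ig gj; exists i, j.
by split; apply/imsetP; [exists i|exists j]; rewrite ?inE.
Qed.

Lemma active_large a g : n <= g -> active a g = set0.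
Proof.
move=> ng; apply/setP => l; rewrite in_set0; apply/negP => /activeP[i [j [_ gj _ _]]].
by have := ltn_ord j; rewrite ltnNge (leq_trans ng gj).
Qed.

Lemma active_labels a g : active a g \subset labels a.
Proof. by apply/subsetP => l /activeP[i [j [_ _ <- _]]]; apply: imset_f. Qed.

Hypothesis m_gt0 : 0 < m.
(* The indices served by the active labels split into m.+1 consecutive blocks,
   each of which can be served by a single label. *)
Hypothesis regroup : forall a g, (forall i, ok i (a i)) ->
  exists (blk : 'I_n -> 'I_m.+1) (r : 'I_m.+1 -> L),
    (forall i j : 'I_n, a i \in active a g -> a j \in active a g ->
       i <= j -> blk i <= blk j) /\
    (forall i, a i \in active a g -> ok i (r (blk i))).

(* The factor makes the order lexicographic: first the number of labels, then
   the total number of gaps at which they are active. *)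
Definition weight a : nat :=
  #|labels a| * (n.+1 * #|L|).+1 + \sum_(g < n.+1) #|active a g|.

(** Serving each block by one label removes at least [m.+1] labels and adds at most [m.+1]. If the
    number of labels stays the same, the new ones are distinct and differ from the kept ones. Then
    at most one new label is active at any gap, and only where a replaced one was active, so the
    second summand drops at gap [g]. *)
Lemma regroup_weight a g : (forall i, ok i (a i)) -> m < #|active a g| ->
  exists a', [/\ forall i, ok i (a' i), #|labels a'| <= #|labels a|
    & weight a' < weight a].
Proof.
move=> oka dg; have [blk [r [bmono bok]]] := regroup g oka.
set A := active a g in dg bmono bok.
pose a' i := if a i \in A then r (blk i) else a i.
pose Q := [set r b | b : 'I_m.+1].
have cQ : #|Q| <= m.+1 by rewrite (leq_trans (leq_imset_card _ _)) // card_ord.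
have cD : #|labels a :\: A| + #|A| = #|labels a|.
  by rewrite cardsD (setIidPr (active_labels a g)) subnK // subset_leq_card // active_labels.
have sub : labels a' \subset (labels a :\: A) :|: Q.
  apply/subsetP => l /imsetP[i _ ->]; rewrite /a' !inE.
  case: ifP => h; first by rewrite imset_f ?orbT.
  by rewrite h imset_f.
have cU := cardsUI (labels a :\: A) Q; have cS := subset_leq_card sub.
have le : #|labels a'| <= #|labels a| by lia.
exists a'; split=> //; first by move=> i; rewrite /a'; case: ifP => // /bok.
rewrite /weight.
have bnd b : \sum_(g < n.+1) #|active b g| <= n.+1 * #|L|.
  rewrite (leq_trans (leq_sum _ (fun i _ => max_card _))) //.
  by rewrite sum_nat_const card_ord.
move: le; rewrite leq_eqVlt => /orP[/eqP e|lt]; last first.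
  have := bnd a'; have : #|labels a'|.+1 * (n.+1 * #|L|).+1 <= #|labels a| * (n.+1 * #|L|).+1 by rewrite leq_mul2r lt orbT.
  by rewrite mulSn; lia.
rewrite e ltn_add2l.
have /eqP : #|Q| = m.+1 by lia.
have Qi0 : (labels a :\: A) :&: Q = set0 by apply/eqP; rewrite -cards_eq0; apply/eqP; lia.
rewrite -[in X in _ == X](card_ord m.+1) => /imset_injP rinj.
have inI i : a' i \in Q -> a i \in A.
  rewrite /a'; case: ifP => // h q.
  have : a i \in (labels a :\: A) :&: Q by rewrite inE q inE h imset_f.
  by rewrite Qi0 inE.
(* Blocks are consecutive among the indices served by [A]. Of two blocks with indices on both sides
   of [h], each lies weakly before the other, so they coincide. *)
have one h : #|active a' h :&: Q| <= 1.
  apply/card_le1_eqP => l1 l2 /setIP[/activeP[i [j [ih hj e1 e2]]] q1].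
  case/setIP=> /activeP[i' [j' [ih' hj' e1' e2']]] q2.
  have I1 : a i \in A by apply: inI; rewrite e1.
  have J1 : a j \in A by apply: inI; rewrite e2.
  have I2 : a i' \in A by apply: inI; rewrite e1'.
  have J2 : a j' \in A by apply: inI; rewrite e2'.
  move: e1 e2 e1' e2'; rewrite /a' I1 J1 I2 J2 => e1 e2 e1' e2'.
  have b1 : blk i = blk j by apply: rinj; rewrite // e1 e2.
  have b2 : blk i' = blk j' by apply: rinj; rewrite // e1' e2'.
  rewrite -e1 -e1'; congr r; apply/val_inj/eqP.
  have := bmono i j' I1 J2; have := bmono i' j I2 J1.
  by have := congr1 val b1; have := congr1 val b2; move=> /=; lia.
have dsub h : active a' h :\: Q \subset active a h :\: A.
  apply/subsetP => l /setDP[/activeP[i [j [ih hj e1 e2]]] q].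
  have nI k : a' k = l -> (a k \notin A) && (a k == l).
    move=> ek; move: q; rewrite -ek /a'; case: ifP => [_|nA _]; last by rewrite /= eqxx.
    by rewrite imset_f.
  case/andP: (nI i e1) => Ai /eqP e1'; case/andP: (nI j e2) => Aj /eqP e2'.
  rewrite inE -e1' Ai /=; apply/activeP; exists i, j; split=> //.
  by rewrite e1' e2'.
have cle h : #|active a' h| <= #|active a h|.
  have c1 := cardsID Q (active a' h); have c2 := cardsID A (active a h).
  have c3 := subset_leq_card (dsub h).
  have [z|] := posnP #|active a' h :&: Q|; first by lia.
  move=> p; suff : 0 < #|active a h :&: A| by have := one h; lia.
  move: p; rewrite !card_gt0 => /set0Pn[l /setIP[/activeP[i [j [ih hj e1 e2]]] q]].
  have I1 : a i \in A by apply: inI; rewrite e1.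
  have J1 : a j \in A by apply: inI; rewrite e2.
  apply/set0Pn.
  have /activeP[i1 [j1 [i1g gj1 ei1 ej1]]] := I1.
  have /activeP[i2 [j2 [i2g gj2 ei2 ej2]]] := J1.
  (* The labels of [i] and [j] were active at [g]: the first reaches from [i] across [g], the second
     from below [g] up to [j], so one of them crosses [h]. *)
  have [hg|gh] := leqP h g.
    exists (a i); rewrite inE I1 andbT; apply/activeP; exists i, j1.
    by rewrite (leq_trans hg gj1).
  exists (a j); rewrite inE J1 andbT; apply/activeP; exists i2, j.
  by rewrite (leq_trans i2g (ltnW gh)).
have gn : g < n.+1.
  by rewrite ltnS leqNgt; apply/negP => /ltnW /(active_large a) e0; rewrite /A e0 cards0 in dg.
rewrite (bigD1 (Ordinal gn)) //= [X in _ < X](bigD1 (Ordinal gn)) //=.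
rewrite -addSn leq_add ?leq_sum //.
(* At [g] all active labels are replaced: more than [m] of them become at most one, a strict
   decrease since [m] is positive. *)
have c1 := cardsID Q (active a' g); have := one g.
have := subset_leq_card (dsub g); rewrite -/A setDv cards0.
lia.
Qed.

Lemma bounded_depth a : (forall i, ok i (a i)) ->
  exists a', [/\ forall i, ok i (a' i), #|labels a'| <= #|labels a|
    & forall g, #|active a' g| <= m].
Proof.
have [k] := ubnP (weight a); elim: k a => // k IH a wk oka.
have [[g dg]|nog] : (exists g, m < #|active a g|) \/ (forall g, #|active a g| <= m).
  case: (pickP (fun g : 'I_n.+1 => m < #|active a g|)) => [g dg|no].
    by left; exists g.
  right=> g; case: (ltnP g n.+1) => [gn|ng].
    by have := no (Ordinal gn) => /=; lia.
  by rewrite active_large ?cards0 // ltnW.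
  have [b [okb lb wb]] := regroup_weight oka dg.
  have [c [okc lc dc]] := IH b (leq_trans wb wk) okb.
  by exists c; split=> //; apply: leq_trans lc lb.
by exists a.
Qed.

End Depth.

(** * Optimality of the table of savings *)

Section Digits.
Variable B : nat.
Hypothesis B_gt0 : 0 < B.

Definition dig k c := (c %/ B ^ k) %% B.

Definition set_dig k v c := c - dig k c * B ^ k + v * B ^ k.

Lemma ltn_dig k c : dig k c < B.
Proof. by rewrite ltn_mod. Qed.

Lemma dig_split k c :
  c = c %/ B ^ k.+1 * B ^ k.+1 + dig k c * B ^ k + c %% B ^ k.
Proof.
rewrite {1}(divn_eq c (B ^ k)) {1}(divn_eq (c %/ B ^ k) B) -divnMA -expnSr.
by rewrite mulnDl -mulnA -expnS.
Qed.

Lemma dig_le k c : dig k c * B ^ k <= c.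
Proof. by rewrite [X in _ <= X](dig_split k c) addnAC leq_addl. Qed.

Lemma set_digE k v c :
  set_dig k v c = c %/ B ^ k.+1 * B ^ k.+1 + v * B ^ k + c %% B ^ k.
Proof. by rewrite /set_dig [X in X - _](dig_split k c) addnAC addnK addnAC. Qed.

Lemma set_dig_div k v c m : v < B -> k < m -> set_dig k v c %/ B ^ m = c %/ B ^ m.
Proof.
move=> vB km; rewrite -(subnKC km) expnD !divnMA; congr (_ %/ _).
rewrite set_digE -addnA divnMDl ?expn_gt0 ?B_gt0 //.
rewrite [X in _ + X]divn_small ?addn0 //.
have p : 0 < B ^ k by rewrite expn_gt0 B_gt0.
have r := ltn_pmod c p; apply: (@leq_trans (v.+1 * B ^ k)).
  by rewrite mulSn addnC ltn_add2r.
by rewrite expnS leq_mul2r vB orbT.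
Qed.

Lemma dig_set_dig k v c k' : v < B ->
  dig k' (set_dig k v c) = if k' == k then v else dig k' c.
Proof.
move=> vB; rewrite /dig; case: (ltngtP k' k) => [lt|gt|->].
- rewrite set_digE [in RHS](divn_eq c (B ^ k)).
  have -> : c %/ B ^ k.+1 * B ^ k.+1 + v * B ^ k = (c %/ B ^ k.+1 * B + v) * B ^ k.
    by rewrite expnS; lia.
  have -> : B ^ k = B ^ (k - k'.+1) * B * B ^ k'.
    by rewrite -expnSr -expnD; congr (B ^ _); lia.
  rewrite !mulnA !divnMDl ?expn_gt0 ?B_gt0 //.
  by rewrite !modnMDl.
- by rewrite set_dig_div.
- rewrite set_digE.
  have -> : c %/ B ^ k.+1 * B ^ k.+1 + v * B ^ k = (c %/ B ^ k.+1 * B + v) * B ^ k.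
    by rewrite expnS; lia.
  rewrite divnMDl ?expn_gt0 ?B_gt0 // [X in _ + X]divn_small ?ltn_mod ?expn_gt0 ?B_gt0 //.
  by rewrite addn0 modnMDl modn_small.
Qed.

Lemma digDM m k q c : k < m -> dig k (q * B ^ m + c) = dig k c.
Proof.
move=> km; rewrite /dig.
have -> : B ^ m = B ^ (m - k.+1) * B * B ^ k.
  by rewrite -expnSr -expnD; congr (B ^ _); lia.
by rewrite !mulnA divnMDl ?expn_gt0 ?B_gt0 // modnMDl.
Qed.

End Digits.

(** * Every assignment of small depth bounds the table from below *)

Section Completeness.
(* A cell [c] encodes a state of the sweep, which serves the points in decreasing
   order of their indices: [c %/ M] points remain, and the [m] last digits of [c]
   in base [B] are the disks held, numbered from 1, with 0 for a free slot.
   [val c] is the number of points that remain minus the number of disks yet to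
   be bought; counting savings instead of costs makes 0 a correct initial value
   for every cell. *)
Variables (n m : nat) (L : finType) (a : 'I_n -> L) (disc : L -> nat).
Variables (cov : nat -> nat -> bool) (val : nat -> nat).
Let B := n.+1.
Let M := B ^ m.
Hypothesis disc_ok : forall l, 0 < disc l <= n.
Hypothesis a_cov : forall i : 'I_n, cov i.+1 (disc (a i)).
Hypothesis a_depth : forall g, #|active a g| <= m.
Hypothesis val_skip : forall c, M <= c < n.+1 * M -> val (c - M) <= val c.
Hypothesis val_use : forall c k, M <= c < n.+1 * M -> k < m ->
  cov (c %/ M) (dig B k c) -> (val (c - M)).+1 <= val c.
Hypothesis val_drop : forall c k, c < n.+1 * M -> k < m -> 0 < dig B k c ->
  val (c - dig B k c * B ^ k) <= val c.
Hypothesis val_buy : forall c k, c < n.+1 * M -> k < m ->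
  cov (c %/ M).+1 (dig B k c) -> val c <= val (c + M - dig B k c * B ^ k).

(** [disc] is not assumed injective, so slots are assigned labels rather than disk numbers. No label
    has two slots, hence a slot is free as long as [#|A| < m]. *)
Definition slots (s : 'I_m -> option L) (A : {set L}) :=
  (forall l, l \in A <-> exists k, s k = Some l) /\
  (forall k k' l, s k = Some l -> s k' = Some l -> k = k').

Definition sdisc o := if o is Some l then disc l else 0.

Definition holds c j s := c %/ M = j /\ forall k : 'I_m, dig B k c = sdisc (s k).

Lemma slots_free s A : slots s A -> #|A| < m -> exists k, s k = None.
Proof.
move=> [sA sI] cA; case: (pickP (fun k => s k == None)) => [k /eqP|no]; first by exists k.
have e k : exists l, s k = Some l by have := no k; case: (s k) => // l _; exists l.
suff : m <= #|A| by lia.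
have sinj : injective s.
  by move=> k k' ek; case: (e k) => l el; apply: (sI _ _ l) => //; rewrite -ek.
pose T := [set s k | k : 'I_m].
have cT : #|T| = m by rewrite card_imset // card_ord.
have Si : injective (@Some L) by move=> x y [].
rewrite -cT -[X in _ <= X](card_imset (mem A) Si) subset_leq_card //.
apply/subsetP => o /imsetP[k _ ->]; case: (e k) => l el; rewrite el.
by apply: imset_f; apply/sA; exists k.
Qed.

Lemma beforeS (i : 'I_n) : before a i.+1 = a i |: before a i.
Proof.
apply/setP => l; rewrite in_setU1; apply/imsetP/orP => [[j]|].
  rewrite inE ltnS leq_eqVlt => /orP[/eqP ji ->|ji ->].
    by left; rewrite (_ : j = i) //; apply: val_inj.
  by right; apply: imset_f; rewrite inE.
case=> [/eqP->|/imsetP[j]]; first by exists i; rewrite ?inE.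
by rewrite inE => ji ->; exists j; rewrite // inE ltnS ltnW.
Qed.

Lemma afterS (i : 'I_n) : after a i = a i |: after a i.+1.
Proof.
apply/setP => l; rewrite in_setU1; apply/imsetP/orP => [[j]|].
  rewrite inE leq_eqVlt => /orP[/eqP ji ->|ji ->].
    by left; rewrite (_ : j = i) //; apply: val_inj.
  by right; apply: imset_f; rewrite inE.
case=> [/eqP->|/imsetP[j]]; first by exists i; rewrite ?inE.
by rewrite inE => ji ->; exists j; rewrite // inE ltnW.
Qed.

Definition sset (s : 'I_m -> option L) k o k' := if k' == k then o else s k'.

Lemma slots_del s A k l : slots s A -> s k = Some l -> slots (sset s k None) (A :\ l).
Proof.
move=> [sA sI] sk; split=> [l'|k1 k2 l'].
  rewrite in_setD1; split=> [/andP[ne /sA[k' sk']]|[k']].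
    exists k'; rewrite /sset; case: eqP => // e; move: ne.
    by move: sk'; rewrite e sk => -[->]; rewrite eqxx.
  rewrite /sset; case: eqP => // ne sk'; apply/andP; split; last by apply/sA; exists k'.
  by apply/eqP => e; apply: ne; apply: sI sk; rewrite -e.
by rewrite /sset; do 2 case: eqP => //; move=> _ _; apply: sI.
Qed.

Lemma slots_add s A k l : slots s A -> s k = None -> l \notin A ->
  slots (sset s k (Some l)) (l |: A).
Proof.
move=> [sA sI] sk lA; split=> [l'|k1 k2 l'].
  rewrite in_setU1; split=> [/orP[/eqP->|/sA[k' sk']]|[k']].
  - by exists k; rewrite /sset eqxx.
  - by exists k'; rewrite /sset; case: eqP => // e; move: sk'; rewrite e sk.
  rewrite /sset; case: eqP => [_ [->]|_ sk']; first by rewrite eqxx.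
  by apply/orP; right; apply/sA; exists k'.
have nl k' : s k' <> Some l by move=> e; move: lA; apply/negP/negPn/sA; exists k'.
rewrite /sset; case: eqP => [->|_]; case: eqP => [->|_] //; last exact: sI.
  by move=> [<-] /nl.
by move=> e1 [e2]; move: e1; rewrite -e2 => /nl.
Qed.

Lemma B_gt0 : 0 < B. Proof. by []. Qed.
Lemma M_gt0 : 0 < M. Proof. by rewrite expn_gt0. Qed.

Lemma sdisc_lt o : sdisc o < B.
Proof. by case: o => //= l; have := disc_ok l; rewrite /B; lia. Qed.

Lemma holds_set c j s (k : 'I_m) o : holds c j s ->
  holds (set_dig B k (sdisc o) c) j (sset s k o).
Proof.
move=> [cj cs]; split; first by rewrite set_dig_div ?sdisc_lt.
move=> k'; rewrite dig_set_dig ?sdisc_lt // /sset -(inj_eq val_inj).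
by case: eqP.
Qed.

Lemma holds_sub c j s : holds c j.+1 s -> M <= c /\ holds (c - M) j s.
Proof.
move=> [cj cs].
have Mc : M <= c by rewrite leqNgt; apply/negP => h; rewrite divn_small in cj.
split=> //; split.
  by move: cj; rewrite -{1}(subnKC Mc) divnDl ?dvdnn // divnn M_gt0 add1n => -[].
move=> k; rewrite -cs -[in RHS](subnKC Mc) -[X in _ = dig _ _ (X + _)]mul1n.
by rewrite digDM // B_gt0.
Qed.

Lemma holds_lt c j s : holds c j s -> j <= n -> c < n.+1 * M.
Proof. by move=> [cj _] jn; rewrite -ltn_divLR ?M_gt0 // cj ltnS. Qed.

(** The labels in [before a j] but not in [active a j] are those yet to be bought when [j] points
    remain. The label of the next point is held if it is active at [j.+1], and needed again if it
    lies in [before a j]. Held and needed: use; held only: use, then drop; needed only: buy;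
    neither: skip. *)
Lemma schedule_bound j : j <= n -> forall s c, slots s (active a j) -> holds c j s ->
  j + #|active a j| <= val c + #|before a j|.
Proof.
elim: j => [_ s c _ _|j IH jn s c sl ho].
  by rewrite add0n (leq_trans _ (leq_addl _ _)) // subset_leq_card // subsetIl.
pose i := Ordinal jn.
have bS : before a j.+1 = a i |: before a j by rewrite -(beforeS i).
have aS : after a j = a i |: after a j.+1 by rewrite -(afterS i).
have [Mc ho'] := holds_sub ho.
have cl := holds_lt ho jn.
have cl' : c - M < n.+1 * M by lia.
have cj : c %/ M = j.+1 by case: ho.
have cj' : (c - M) %/ M = j by case: ho'.
have Mcl : M <= c < n.+1 * M by rewrite Mc.
have IHj := IH (ltnW jn).
have [act|nact] := boolP (a i \in active a j.+1).
  have [k sk] := (sl.1 (a i)).1 act.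
  have dk : dig B k c = disc (a i) by rewrite ho.2 sk.
  have U : (val (c - M)).+1 <= val c.
    by apply: (val_use Mcl (ltn_ord k)); rewrite cj dk (a_cov i).
  have aft : after a j = after a j.+1.
    by rewrite aS; apply/setUidPr; rewrite sub1set; case/setIP: act.
  have [bef|nbef] := boolP (a i \in before a j).
    have be : before a j.+1 = before a j by rewrite bS; apply/setUidPr; rewrite sub1set.
    have ae : active a j = active a j.+1 by rewrite /active aft be.
    by have := IHj s (c - M); rewrite ae be => /(_ sl ho'); lia.
  have ae : active a j = active a j.+1 :\ a i.
    apply/setP => l; rewrite !inE aft bS in_setU1.
    by case: eqP => [->|] //=; rewrite (negPf nbef).
  have := IHj _ _ _ (holds_set k None ho'); rewrite ae => /(_ (slots_del sl sk)).
  have := cardsD1 (a i) (active a j.+1); rewrite act /=.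
  rewrite bS cardsU1 nbef /= /set_dig mul0n addn0.
  have : val (c - M - dig B k (c - M) * B ^ k) <= val (c - M).
    apply: val_drop => //; rewrite ho'.2 sk /=; by have := disc_ok (a i); lia.
  lia.
have na : a i \notin after a j.+1.
  by apply: contra nact => h; rewrite inE h andbT bS setU11.
have [bef|nbef] := boolP (a i \in before a j).
  have be : before a j.+1 = before a j by rewrite bS; apply/setUidPr; rewrite sub1set.
  have ae : active a j = a i |: active a j.+1.
    apply/setP => l; rewrite /active aS be !inE.
    by case: eqP => [->|] //=; rewrite bef.
  have ca : #|active a j| = #|active a j.+1|.+1 by rewrite ae cardsU1 nact.
  have [k sk] : exists k, s k = None by apply: (slots_free sl); rewrite -ca.
  have ho2 := holds_set k (Some (a i)) ho'.
  have := IHj _ _ _ ho2; rewrite ae => /(_ (slots_add sl sk nact)).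
  rewrite -ae ca be.
  (* [c2] is [c - M] with the free slot [k] filled. Erasing that digit and adding [M] gives back
     [c], so [val_buy] at [c2] bounds [val c] from below. *)
  set c2 := set_dig _ _ _ _ in ho2 *.
  have d2 : dig B k c2 = disc (a i) by rewrite ho2.2 /sset eqxx.
  have cc : c2 + M - dig B k c2 * B ^ k = c.
    rewrite d2 /c2 /set_dig (ho'.2 k) sk /= mul0n subn0; lia.
  have := @val_buy c2 k (holds_lt ho2 (ltnW jn)) (ltn_ord k).
  by rewrite cc d2 ho2.1 (a_cov i) => /(_ isT); lia.
have ae : active a j = active a j.+1.
  apply/setP => l; rewrite /active aS bS !inE.
  by case: eqP => [->|] //=; rewrite (negPf nbef) (negPf na).
have := IHj s (c - M); rewrite ae => /(_ sl ho').
by have := val_skip Mcl; rewrite bS cardsU1 nbef; lia.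
Qed.

Lemma val_top : n <= val (n * M) + #|labels a|.
Proof.
have a0 : active a n = set0 by apply: active_large.
have := @schedule_bound n (leqnn n) (fun => None) (n * M).
rewrite a0 cards0 addn0 (_ : before a n = labels a); last first.
  by apply/setP => l; apply/imsetP/imsetP => -[i _ ->]; exists i; rewrite ?inE.
apply; first by split=> // l; rewrite inE; split=> // -[].
split; first by rewrite mulnK ?M_gt0.
by move=> k; rewrite -[n * M]addn0 digDM // /dig div0n mod0n.
Qed.

End Completeness.

(* [E d s g b]: cell [s] is a successor of cell [d], with gain [g], and the disk
   [b] is bought on the way, unless [b = 0]. *)
Definition edges := nat -> nat -> nat -> nat -> Prop.

(** * Relaxation of one edge *)

Section Relaxation.

Definition best (E : edges) (val nxt buy : nat -> nat) d :=
  exists2 g, E d (nxt d) g (buy d) & val d = val (nxt d) + g.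

(* Sources of edges lie below the frontier [f], so that their values are final. *)
Definition relaxed f (E : edges) val nxt buy :=
  (forall d s g b, E d s g b -> [/\ s < f, val s + g <= val d & best E val nxt buy d])
  /\ (forall d, best E val nxt buy d \/ val d = 0).

Lemma relaxed_ext f E E' val nxt buy val' nxt' buy' :
  (forall d s g b, E d s g b <-> E' d s g b) ->
  val =1 val' -> nxt =1 nxt' -> buy =1 buy' ->
  relaxed f E val nxt buy -> relaxed f E' val' nxt' buy'.
Proof.
move=> eE ev en eb [r1 r2].
have bb d : best E val nxt buy d -> best E' val' nxt' buy' d.
  by move=> [g /eE e1 e2]; exists g; rewrite -?ev -?en -?eb.
split=> [d s g b /eE /r1[h1 h2 h3]|d]; first by rewrite -!ev; split=> //; apply: bb.
by rewrite -ev; case: (r2 d) => [/bb|]; [left|right].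
Qed.

Lemma relaxed_le f f' E val nxt buy : f <= f' ->
  relaxed f E val nxt buy -> relaxed f' E val nxt buy.
Proof.
move=> ff [r1 r2]; split=> // d s g b /r1[h1 h2 h3].
by split=> //; apply: leq_trans h1 ff.
Qed.

Definition add_edge (E : edges) d0 s0 g0 b0 : edges :=
  fun d s g b => E d s g b \/ (d, s, g, b) = (d0, s0, g0, b0).

(** The strict inequality makes [val d0] positive, so [d0] already has a recorded successor; after a
    tie at value 0 it might have none. *)
Lemma relaxed_keep f E val nxt buy d0 s0 g0 b0 : s0 < f ->
  relaxed f E val nxt buy -> val s0 + g0 < val d0 ->
  relaxed f (add_edge E d0 s0 g0 b0) val nxt buy.
Proof.
move=> sf [r1 r2] lt.
have bb d : best E val nxt buy d -> best (add_edge E d0 s0 g0 b0) val nxt buy d.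
  by move=> [g e1 e2]; exists g => //; left.
split=> [d s g b [/r1[h1 h2 h3]|[-> -> -> _]]|d].
- by split=> //; apply: bb.
- split=> //; first exact: ltnW.
  by apply: bb; case: (r2 d0) => // e; rewrite e in lt.
- by case: (r2 d) => [/bb|]; [left|right].
Qed.

(** Since [d0] is not below the frontier, it is no source, and raising its value leaves the recorded
    equations of all other cells intact. *)
Lemma relaxed_set f E val nxt buy d0 s0 g0 b0 val' nxt' buy' : s0 < f -> f <= d0 ->
  relaxed f E val nxt buy -> val d0 <= val s0 + g0 ->
  (forall x, val' x = if x == d0 then val s0 + g0 else val x) ->
  (forall x, nxt' x = if x == d0 then s0 else nxt x) ->
  (forall x, buy' x = if x == d0 then b0 else buy x) ->
  relaxed f (add_edge E d0 s0 g0 b0) val' nxt' buy'.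
Proof.
move=> sf fd [r1 r2] le ev en eb.
have old s : s < f -> val' s = val s by rewrite ev; case: eqP => // ->; lia.
have mon d : val d <= val' d by rewrite ev; case: eqP => // ->.
have new : best (add_edge E d0 s0 g0 b0) val' nxt' buy' d0.
  by exists g0; rewrite ?en ?eb ?ev !eqxx; [right|rewrite -ev old].
have bb d : best E val nxt buy d -> best (add_edge E d0 s0 g0 b0) val' nxt' buy' d.
  have [-> //|ne] := eqVneq d d0; move=> [g e1 e2]; exists g.
    by rewrite en eb (negPf ne); left.
  by rewrite en ev (negPf ne) old //; case/r1: e1.
split=> [d s g b [/r1[h1 h2 h3]|[-> -> -> _]]|d].
- by split=> //; [rewrite old // (leq_trans h2)|apply: bb].
- by split=> //; rewrite old // ev eqxx.
- case: (r2 d) => [/bb|]; first by left.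
  have [-> _|ne e] := eqVneq d d0; first by left.
  by right; rewrite ev (negPf ne).
Qed.

End Relaxation.

(** * The graph of cells and the trace of an optimal path *)

Section Edges.
Variables (n m : nat) (own : nat -> nat) (cov : nat -> nat -> bool).
Let B := n.+1.
Let M := B ^ m.

(* [PullSkip] buys a disk at the point itself and forgets it at once, [PullUse]
   serves the point with the disk of slot [k], [PullDrop] frees that slot, and
   [PushBuy] serves the point with a new disk, which then occupies a free slot of
   the destination. *)
Inductive pull (K c : nat) : edges :=
| PullSkip : 0 < own (c %/ M) -> pull K c c (c - M) 0 (own (c %/ M))
| PullUse k : 0 < own (c %/ M) -> k < K -> cov (c %/ M) (dig B k c) ->
    pull K c c (c - M) 1 0
| PullDrop k : 0 < own (c %/ M) -> k < K -> 0 < dig B k c ->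
    pull K c c (c - dig B k c * B ^ k) 0 0.

Inductive push (K c : nat) : edges :=
| PushBuy k : k < K -> cov (c %/ M).+1 (dig B k c) ->
    push K c (c + M - dig B k c * B ^ k) c 0 (dig B k c).

Inductive upto (f : nat) : edges :=
| UptoPull c d s g b : c < f -> pull m c d s g b -> upto f d s g b
| UptoPush c d s g b : c < f -> push m c d s g b -> upto f d s g b.

Hypothesis own0 : own 0 = 0.
Hypothesis own_gt0 : forall j, 0 < j <= n -> 0 < own j.
Hypothesis cov_own : forall j, 0 < own j -> cov j (own j).
Hypothesis cov_bound : forall j v, cov j v -> 0 < v <= n /\ 0 < j <= n.
Variables val nxt buy : nat -> nat.
Hypothesis rel : relaxed (n.+1 * M) (upto (n.+1 * M)) val nxt buy.

Let M_gt0 : 0 < M. Proof. by rewrite expn_gt0. Qed.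

Lemma layP c : M <= c < n.+1 * M -> 0 < c %/ M <= n.
Proof.
by case/andP=> Mc cl; rewrite divn_gt0 // Mc -ltnS ltn_divLR.
Qed.

Lemma relaxed_skip c : M <= c < n.+1 * M -> val (c - M) <= val c.
Proof.
move=> cl; have /andP[_ cl2] := cl; have o := own_gt0 (layP cl).
by have [] := rel.1 _ _ _ _ (UptoPull cl2 (PullSkip m o)); rewrite addn0.
Qed.

Lemma relaxed_use c k : M <= c < n.+1 * M -> k < m -> cov (c %/ M) (dig B k c) ->
  val (c - M) < val c.
Proof.
move=> cl km cv; have /andP[_ cl2] := cl; have o := own_gt0 (layP cl).
by have [] := rel.1 _ _ _ _ (UptoPull cl2 (PullUse o km cv)); rewrite addn1.
Qed.

Lemma push_ge c k : M <= c + M - dig B k c * B ^ k.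
Proof. by rewrite addnC -addnBA ?leq_addr // dig_le. Qed.

(** Layer 0 is never a destination and keeps its initial value 0, which is correct: no point remains
    and no disk has to be bought. *)
Lemma upto_ge f d s g b : upto f d s g b -> M <= d.
Proof.
have pos c : 0 < own (c %/ M) -> M <= c.
  by move=> o; rewrite leqNgt; apply/negP => cM; rewrite divn_small // own0 in o.
by case=> c {}d {}s {}g {}b _ [] *; rewrite ?push_ge ?pos.
Qed.

Lemma relaxed_layer0 c : c < M -> val c = 0.
Proof. by move=> cM; case: (rel.2 c) => // -[g /upto_ge]; rewrite leqNgt cM. Qed.

Lemma relaxed_drop c k : c < n.+1 * M -> k < m -> 0 < dig B k c ->
  val (c - dig B k c * B ^ k) <= val c.
Proof.
move=> cl km d0; have [cM|Mc] := ltnP c M.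
  by rewrite relaxed_layer0 //; lia.
have o : 0 < own (c %/ M) by apply: own_gt0; apply: layP; rewrite Mc.
by have [] := rel.1 _ _ _ _ (UptoPull cl (PullDrop o km d0)); rewrite addn0.
Qed.

Lemma relaxed_buy c k : c < n.+1 * M -> k < m -> cov (c %/ M).+1 (dig B k c) ->
  val c <= val (c + M - dig B k c * B ^ k).
Proof.
move=> cl km cv.
by have [] := rel.1 _ _ _ _ (UptoPush cl (PushBuy km cv)); rewrite addn0.
Qed.

Definition marked (mark : nat -> nat) := count (fun v => 0 < mark v) (iota 1 n).

(** On the way to [cur], [n - cur %/ M] points were served and [val (n * M) - val cur] savings
    collected; the last clause bounds the number of marks by the difference. It is an inequality
    because a disk that is bought twice is marked once. *)
Definition traced cur mark :=
  [/\ cur < n.+1 * M,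
      forall k, k < m -> 0 < dig B k cur -> 0 < mark (dig B k cur),
      forall j, cur %/ M < j <= n -> exists2 v, 0 < mark v & cov j v
    & marked mark + val (n * M) + cur %/ M <= n + val cur].

Definition add_mark (mark : nat -> nat) b v := if (0 < b) && (v == b) then 1 else mark v.

Lemma marked_add mark b : marked (add_mark mark b) <= (marked mark).+1.
Proof.
rewrite /marked; have le1 : count (pred1 b) (iota 1 n) <= 1.
  by rewrite count_uniq_mem ?iota_uniq //; case: (_ \in _).
apply: (@leq_trans (count (predU (pred1 b) (fun v => 0 < mark v)) (iota 1 n))).
  by apply: sub_count => v /=; rewrite /add_mark; case: andP => [[_ ->]|_ ->] //; rewrite orbT.
rewrite -add1n; apply: leq_trans (leq_add le1 (leqnn _)).
by rewrite -count_predUI leq_addr.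
Qed.

Lemma add_mark_gt0 mark b v : 0 < mark v -> 0 < add_mark mark b v.
Proof. by rewrite /add_mark; case: ifP. Qed.

Lemma add_markE mark b : 0 < b -> 0 < add_mark mark b b.
Proof. by rewrite /add_mark eqxx => ->. Qed.

Lemma traced0 : traced (n * M) (fun=> 0).
Proof.
split.
- by rewrite ltn_mul2r M_gt0 ltnS leqnn.
- by move=> k km; rewrite -[n * M]addn0 digDM // /dig div0n mod0n.
- by move=> j; rewrite mulnK // ltnNge andNb.
- by rewrite mulnK // /marked count_pred0 add0n addnC.
Qed.

Lemma sub_layer c : M <= c ->
  (c - M) %/ M = (c %/ M).-1 /\ forall k, k < m -> dig B k (c - M) = dig B k c.
Proof.
move=> Mc; split=> [|k km].
  by rewrite -[X in _ = (X %/ _).-1](subnKC Mc) divnDl ?dvdnn // divnn M_gt0.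
by rewrite -[in RHS](subnKC Mc) -[X in _ = dig _ _ (X + _)]mul1n digDM.
Qed.

Lemma upto_cases f d s g b : upto f d s g b ->
  [\/ [/\ s = d - M, g = 0 & b = own (d %/ M)],
      exists2 k, k < m & [/\ cov (d %/ M) (dig B k d), s = d - M, g = 1 & b = 0],
      exists2 k, k < m & [/\ 0 < dig B k d, s = d - dig B k d * B ^ k, g = 0 & b = 0]
    | exists2 k, k < m & [/\ d = s + M - dig B k s * B ^ k,
                             cov (s %/ M).+1 (dig B k s), g = 0 & b = dig B k s]].
Proof.
case=> c {}d {}s {}g {}b _ [].
- by move=> _; apply: Or41.
- by move=> k _ km cv; apply: Or42; exists k.
- by move=> k _ km cv; apply: Or43; exists k.
- by move=> k km cv; apply: Or44; exists k.
Qed.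

Lemma traced_step cur mark : M <= cur -> traced cur mark ->
  nxt cur < cur /\ traced (nxt cur) (add_mark mark (buy cur)).
Proof.
move=> Mc [cl ds cs le]; have clM : M <= cur < n.+1 * M by rewrite Mc.
have ml := marked_add mark (buy cur).
have mark0 : add_mark mark 0 = mark by [].
have lp := layP clM; have o := own_gt0 lp.
(* A cell of positive layer always has its skip edge, so its recorded successor is genuine and the
   trace cannot get stuck above layer 0. *)
have [_ _ [g]] := rel.1 _ _ _ _ (UptoPull cl (PullSkip m o)).
have [cM dM] := sub_layer Mc.
have cov_lay v mk : 0 < mk v -> cov (cur %/ M) v -> (forall v, 0 < mark v -> 0 < mk v) ->
    forall j, (cur %/ M).-1 < j <= n -> exists2 v, 0 < mk v & cov j v.
  move=> v0 cv sub j jb; have [cj|cj] := ltnP (cur %/ M) j.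
    by have [|u u0 cu] := cs j; [lia|exists u => //; apply: sub].
  by exists v => //; have -> : j = cur %/ M by lia.
have add0 := @add_mark_gt0 mark (buy cur).
case/upto_cases=> [[-> -> eb]|[k km [cv -> -> eb]]|[k km [d0 -> -> eb]]|[k km [es cv -> eb]]] ev.
- split; first by have := M_gt0; lia.
  split; first by lia.
  + by move=> k km; rewrite dM // => /(ds k km) /add0.
  + rewrite cM eb; apply: (@cov_lay (own (cur %/ M))) => [||v]; first exact: add_markE.
      exact: cov_own.
    exact: add_mark_gt0.
  + by rewrite cM; lia.
- rewrite eb mark0; split; first by have := M_gt0; lia.
  split; [by lia|by move=> k' km'; rewrite dM //; apply: ds| |by rewrite cM; lia].
  rewrite cM; apply: (cov_lay _ _ _ cv) => //; apply: ds => //.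
  by case: (cov_bound cv) => /andP[].
- have Bk : 0 < B ^ k by rewrite expn_gt0.
  have lt : cur - dig B k cur * B ^ k < cur by have : 0 < cur; nia.
  have sE : cur - dig B k cur * B ^ k = set_dig B k 0 cur by rewrite /set_dig mul0n addn0.
  have lE : (cur - dig B k cur * B ^ k) %/ M = cur %/ M by rewrite sE set_dig_div.
  rewrite eb mark0; split=> //; split; [by lia| |by rewrite lE|by rewrite lE; lia].
  by move=> k' km'; rewrite sE dig_set_dig //; case: eqP => // _; apply: ds.
- have [v0 _] := cov_bound cv.
  set s := nxt cur in es cv eb ev *.
  have dl := dig_le B k s.
  have lt : dig B k s * B ^ k < M.
    rewrite (@leq_trans (B * B ^ k)) //; last by rewrite -expnS leq_exp2l // /B; lia.
    by rewrite ltn_mul2r expn_gt0 ltn_dig.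
  (* The path follows a purchase: [s] is [cur - M] with the new disk in slot [k], which is free in
     [cur]. *)
  have sE : cur - M = set_dig B k 0 s by rewrite /set_dig mul0n addn0 es; lia.
  have lE : cur %/ M = (s %/ M).+1.
    have : (cur - M) %/ M = s %/ M by rewrite sE set_dig_div.
    by rewrite cM => <-; lia.
  split; first by lia.
  split; first by lia.
  + move=> k' km' d0; have [->|ne] := eqVneq k' k.
      by rewrite -eb; apply: add_markE; rewrite eb; case/andP: v0.
    apply: add0; have := dM _ km'; rewrite sE dig_set_dig // (negPf ne) => e.
    by rewrite e; apply: ds => //; rewrite -e.
  + have -> : s %/ M = (cur %/ M).-1 by rewrite lE.
    apply: (@cov_lay (buy cur)); [|by rewrite lE eb|exact: add_mark_gt0].
    by apply: add_markE; rewrite eb; case/andP: v0.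
  + by rewrite lE in le; lia.
Qed.

End Edges.

Import Order.TTheory GRing.Theory Num.Theory.

(** * Rows of height 2/3 *)

Section Geometry.
Local Open Scope ring_scope.
Variable R : realType.

Lemma edist_le1 (p q : R * R) :
  (edist p q <= 1) = ((p.1 - q.1) ^+ 2 + (p.2 - q.2) ^+ 2 <= 1).
Proof. by rewrite /edist -[X in _ <= X]sqrtr1 ler_sqrt // ltr01. Qed.

Lemma edist_coord (p q : R * R) : edist p q <= 1 ->
  (`|p.1 - q.1| <= 1) /\ (`|p.2 - q.2| <= 1).
Proof.
rewrite edist_le1 => h; split; rewrite -sqrtr_sqr -sqrtr1 ler_sqrt ?ltr01 //;
  apply: le_trans h; [rewrite lerDl|rewrite lerDr]; exact: sqr_ge0.
Qed.

(** Twice the square of 2/3 is 8/9. *)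
Lemma edist_close (p q : R * R) : `|p.1 - q.1| <= 2 / 3 -> `|p.2 - q.2| <= 2 / 3 ->
  edist p q <= 1.
Proof.
move=> h1 h2; rewrite edist_le1.
have sq (t : R) : `|t| <= 2 / 3 -> t ^+ 2 <= 4 / 9.
  rewrite ler_norml => /andP[? ?].
  have : 0 <= (t + 2 / 3) * (2 / 3 - t) by apply: mulr_ge0; lra.
  lra.
by move: h1 h2 => /sq ? /sq ?; lra.
Qed.

(** Six intervals of length 2/3 tile the width 4 around [z]; the outer two extend to infinity, so
    that [f] is monotone everywhere. *)
Lemma six_blocks (z : R) : exists f : R -> 'I_6,
  (forall u v, u <= v -> (f u <= f v)%N) /\
  (forall u v, `|u - z| <= 2 -> `|v - z| <= 2 -> f u = f v -> `|u - v| <= 2 / 3).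
Proof.
pose f (u : R) : nat :=
  if u <= z - 4 / 3 then 0 else if u <= z - 2 / 3 then 1 else if u <= z then 2
  else if u <= z + 2 / 3 then 3 else if u <= z + 4 / 3 then 4 else 5.
have f6 u : (f u < 6)%N by rewrite /f; do ![case: ifP => _ //].
have fS u : `|u - z| <= 2 -> z - 2 + 2 / 3 * (f u)%:R <= u <= z - 2 + 2 / 3 * (f u)%:R + 2 / 3.
  rewrite ler_norml /f => /andP[? ?].
  do 5 (case: ifP => ?; first by apply/andP; split; lra).
  by apply/andP; split; lra.
exists (fun u => Ordinal (f6 u)); split=> [u v uv|u v /fS /andP[u1 u2] /fS /andP[v1 v2] /(congr1 val) /= e].
  by rewrite /= /f; do 10?(case: ifP => ?); rewrite //=; exfalso; lra.
by rewrite ler_norml; apply/andP; rewrite e in u1 u2; split; lra.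
Qed.

(** * Row numbers and the assignment of cost at most four times the optimum *)

Section Rows.
Variables (n : nat) (own : nat -> nat) (bs : nat -> R) (pt : nat -> R * R).

Definition covers j v := [&& (0 < own j)%N, (0 < v <= n)%N & edist (pt (own j)) (pt v) <= 1].

(** [own j] is the number of the point at position [j]. Outside the range it is 0, which stands for
    no point and makes [covers] false. *)
Record row_sorted : Prop := RowSorted {
  own_range : forall j, (0 < j <= n)%N -> (0 < own j <= n)%N;
  own_out : forall j, ~~ (0 < j <= n)%N -> own j = 0%N;
  own_onto : forall v, (0 < v <= n)%N -> exists2 j, (0 < j <= n)%N & own j = v;
  row_mem : forall j, (0 < j <= n)%N -> bs j <= (pt (own j)).2 <= bs j + 2 / 3;
  row_order : forall i j, (0 < i)%N -> (i < j)%N -> (j <= n)%N ->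
    (bs i = bs j /\ (pt (own i)).1 <= (pt (own j)).1) \/ bs i + 2 / 3 < bs j }.

Hypothesis sorted : row_sorted.

(* [bs j] is the ordinate at which the row of the [j]-th point starts. *)
Definition row j : nat := count (fun t => bs t != bs t.+1) (iota 1 j.-1).

Lemma row_le j : (row j <= j)%N.
Proof. by rewrite (leq_trans (count_size _ _)) // size_iota leq_pred. Qed.

Lemma row_gap i j : (0 < i)%N -> (i <= j)%N -> (j <= n)%N ->
  (row i = row j /\ bs i = bs j) \/
  ((row i < row j)%N /\ bs i + 2 / 3 * (row j - row i)%:R < bs j).
Proof.
move=> i0; elim: j => [|j IH]; first by lia.
rewrite leq_eqVlt => /orP[/eqP <-|]; first by left.
rewrite ltnS => ij jn; have j0 : (0 < j)%N by lia.
have rS : row j.+1 = (row j + (bs j != bs j.+1))%N.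
  have e : iota 1 j = iota 1 j.-1 ++ [:: j] by have := iotaD 1 j.-1 1; rewrite addn1 add1n prednK.
  by rewrite /row /= e count_cat /= addn0.
have [[be _]|lt] := row_order sorted j0 (ltnSn j) jn.
  by rewrite rS be eqxx addn0 -be; apply: IH => //; lia.
have -> : row j.+1 = (row j).+1.
  by rewrite rS; case: eqP => [e|_]; [exfalso; rewrite e in lt; lra|rewrite addn1].
right; case: (IH ij (ltnW jn)) => -[r b].
  by split; [lia|rewrite r subSnn b; lra].
split; first by lia.
by rewrite subSn 1?ltnW // -natr1; lra.
Qed.

Lemma row_mono i j : (0 < i)%N -> (i <= j)%N -> (j <= n)%N -> (row i <= row j)%N.
Proof. by move=> i0 ij jn; case: (row_gap i0 ij jn) => -[]; lia. Qed.

Lemma same_row i j : (0 < i)%N -> (i <= j)%N -> (j <= n)%N -> row i = row j ->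
  (pt (own i)).1 <= (pt (own j)).1 /\ `|(pt (own i)).2 - (pt (own j)).2| <= 2 / 3.
Proof.
move=> i0 ij jn e; have j0 : (0 < j)%N by lia.
have ib : (0 < i <= n)%N by lia.
have jb : (0 < j <= n)%N by lia.
have b : bs i = bs j by case: (row_gap i0 ij jn) => -[] //; lia.
have /andP[i1 i2] := row_mem sorted ib; have /andP[j1 j2] := row_mem sorted jb.
split; last by rewrite ler_norml; apply/andP; split; lra.
move: ij; rewrite leq_eqVlt => /orP[/eqP -> //|lt].
by case: (row_order sorted i0 lt jn) => [[]//|]; lra.
Qed.

(** Four rows further up, the row starts differ by more than 8/3, and so the ordinates by more than
    8/3 - 2/3 = 2, the diameter of a disk. *)
Lemma row_span i j v : (0 < i)%N -> (i <= j)%N -> (j <= n)%N ->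
  covers i v -> covers j v -> (row j <= row i + 3)%N.
Proof.
move=> i0 ij jn /and3P[_ _ /edist_coord[_ ci]] /and3P[_ _ /edist_coord[_ cj]].
rewrite leqNgt; apply/negP => lt.
have ib : (0 < i <= n)%N by lia.
have jb : (0 < j <= n)%N by lia.
have /andP[i1 i2] := row_mem sorted ib; have /andP[j1 j2] := row_mem sorted jb.
case: (row_gap i0 ij jn) => -[r b]; first by lia.
have : 4 <= (row j - row i)%:R :> R by rewrite ler_nat; lia.
by move: ci cj; rewrite !ler_norml => /andP[? ?] /andP[? ?] ?; lra.
Qed.

Lemma pair_fibers (I J : finType) (A : {set I * J}) (D : {set J}) (k : nat) :
  (forall p, p \in A -> p.2 \in D) ->
  (forall q, q \in D -> (#|[set p in A | p.2 == q]| <= k)%N) -> (#|A| <= k * #|D|)%N.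
Proof.
move=> AD fib; rewrite -sum1_card (partition_big (fun p => p.2) (mem D)) //=.
rewrite mulnC -sum_nat_const; apply: leq_sum => q qD.
by rewrite sum1_card (leq_trans _ (fib q qD)) // subset_leq_card //; apply/subsetP => p; rewrite !inE.
Qed.

Notation lab := ('I_n.+1 * 'I_n.+1)%type.
Definition label_ok (i : 'I_n) (l : lab) := (l.1 = row i.+1 :> nat) /\ covers i.+1 l.2.

Lemma regroup_rows (a : 'I_n -> lab) g : (forall i, label_ok i (a i)) ->
  exists (blk : 'I_n -> 'I_6) (r : 'I_6 -> lab),
    (forall i j : 'I_n, a i \in active a g -> a j \in active a g ->
       (i <= j)%N -> (blk i <= blk j)%N) /\
    (forall i, a i \in active a g -> label_ok i (r (blk i))).
Proof.
(* Index [i] has position [i.+1], so position [g] is the last one before the gap. *)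
move=> ok; pose xc j := (pt (own j)).1.
have [f [fmono fclose]] := six_blocks (xc g).
have aP i : a i \in active a g -> row i.+1 = row g /\ `|xc i.+1 - xc g| <= 2.
  move=> /activeP[i1 [j1 [ig gj e1 e2]]].
  have [ri ci] := ok i; have [ri1 ci1] := ok i1; have [rj1 cj1] := ok j1.
  have in_ := ltn_ord i; have jn := ltn_ord j1; have i1n := ltn_ord i1.
  rewrite e1 in ri1 ci1; rewrite e2 in rj1 cj1.
  have m1 := @row_mono i1.+1 g isT ig (leq_trans gj (ltnW jn)).
  have m2 := @row_mono g j1.+1 (leq_ltn_trans (leq0n _) ig) (leqW gj) jn.
  have rg : row i.+1 = row g by lia.
  split=> //.
  have near u v : covers u v -> forall t, covers t v -> `|xc u - xc t| <= 2.
    move=> /and3P[_ _ /edist_coord[+ _]] t /and3P[_ _ /edist_coord[+ _]].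
    by rewrite !ler_norml => /andP[? ?] /andP[? ?]; apply/andP; rewrite /xc; split; lra.
  (* A point with the same label lies on the other side of the gap. The abscissa of position [g] is
     between the two, which share a disk of diameter 2. *)
  have [le|lt] := ltnP i g.
    have [x1 _] := @same_row i.+1 g isT le (leq_trans gj (ltnW jn)) rg.
    have [x2 _] := @same_row g j1.+1 (leq_ltn_trans (leq0n _) ig) (leqW gj) jn ltac:(lia).
    have := near _ _ ci _ cj1; rewrite !ler_norml => /andP[? ?].
    by apply/andP; rewrite /xc in x1 x2 *; split; lra.
  have [x1 _] := @same_row g i.+1 (leq_ltn_trans (leq0n _) ig) (leqW lt) in_ ltac:(lia).
  have [x2 _] := @same_row i1.+1 g isT ig (leq_trans lt (ltnW in_)) ltac:(lia).
  have := near _ _ ci _ ci1; rewrite !ler_norml => /andP[? ?].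
  by apply/andP; rewrite /xc in x1 x2 *; split; lra.
pose blk (i : 'I_n) := f (xc i.+1).
(* Any point of a block serves it: the active points lie in one row, of height 2/3, and those of one
   block span a width of at most 2/3. *)
pose r b : lab := if [pick i : 'I_n | (a i \in active a g) && (blk i == b)] is Some i
  then (inord (row g), inord (own i.+1)) else (ord0, ord0).
exists blk, r; split.
  move=> i j /aP[ri _] /aP[rj _] ij; apply: fmono.
  by case: (@same_row i.+1 j.+1 isT ij (ltn_ord j) ltac:(lia)).
move=> i act; rewrite /r; case: pickP => [j /andP[actj /eqP bj]|/(_ i)]; last first.
  by rewrite act eqxx.
have [ri xi] := aP i act; have [rj xj] := aP j actj.
have jb : (0 < j.+1 <= n)%N by rewrite /= ltn_ord.
have ib : (0 < i.+1 <= n)%N by rewrite /= ltn_ord.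
have /andP[o1 o2] := own_range sorted jb; have /andP[p1 p2] := own_range sorted ib.
split=> /=.
  by rewrite inordK ?ri // -ri ltnS (leq_trans (row_le _) (ltn_ord i)).
rewrite inordK // /covers p1 o1 o2 /=; apply: edist_close.
  by apply: fclose => //.
case/orP: (leq_total i j) => ij.
  by case: (@same_row i.+1 j.+1 isT ij (ltn_ord j) ltac:(lia)).
by rewrite distrC; case: (@same_row j.+1 i.+1 isT ij (ltn_ord i) ltac:(lia)).
Qed.

Lemma row_assignment (D : {set 'I_n.+1}) :
  (forall j, (0 < j <= n)%N -> exists2 v, v \in D & covers j v) ->
  exists a : 'I_n -> lab, [/\ forall i, label_ok i (a i), (#|labels a| <= 4 * #|D|)%N
    & forall g, (#|active a g| <= 5)%N].
Proof.
move=> dom.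
have dom' (i : 'I_n) : exists v, (v \in D) && covers i.+1 v.
  by have [|v vD c] := dom i.+1; [rewrite /= ltn_ord|exists v; rewrite vD].
pose a0 (i : 'I_n) : lab := (inord (row i.+1), xchoose (dom' i)).
have rowK (i : 'I_n) : (inord (row i.+1) : 'I_n.+1) = row i.+1 :> nat.
  by rewrite inordK // ltnS (leq_trans (row_le _) (ltn_ord i)).
have ok0 i : label_ok i (a0 i).
  by split; [exact: rowK|case/andP: (xchooseP (dom' i))].
have [a [oka la da]] := bounded_depth (m := 5) isT regroup_rows ok0.
exists a; split=> //; apply: leq_trans la _; apply: pair_fibers => [p|q qD].
  by case/imsetP=> i _ ->; case/andP: (xchooseP (dom' i)).
pose P (i : 'I_n) := (a0 i).2 == q.
case: (pickP P) => [i0 Pi0|no]; last first.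
  rewrite (_ : [set _ in _ | _] = set0) ?cards0 //; apply/setP => p; rewrite !inE.
  by apply/negP => /andP[/imsetP[i _ ->]]; rewrite -/(P i) no.
(* The first index served by [q] has the lowest row; by [row_span] the others lie at most three rows
   above, which leaves four labels for [q]. *)
case: (arg_minnP (fun i : 'I_n => i : nat) Pi0) => i Pi imin.
pose T := [set ((inord (row i.+1 + t), q) : lab) | t : 'I_4].
apply: (@leq_trans #|T|); last by rewrite (leq_trans (leq_imset_card _ _)) // card_ord.
apply: subset_leq_card; apply/subsetP => p; rewrite inE => /andP[/imsetP[j _ ->] Pj].
have ij := imin _ Pj.
have cj : covers j.+1 q by rewrite -(eqP Pj); case: (ok0 j).
have ci : covers i.+1 q by rewrite -(eqP Pi); case: (ok0 i).
have sp := @row_span i.+1 j.+1 q isT ij (ltn_ord j) ci cj.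
have mo := @row_mono i.+1 j.+1 isT ij (ltn_ord j).
have t4 : (row j.+1 - row i.+1 < 4)%N by lia.
apply/imsetP; exists (Ordinal t4) => //=; rewrite subnKC //.
by rewrite /a0; congr (_, _); apply/eqP.
Qed.

End Rows.
End Geometry.

(** * Programs *)

Section WP.
Variables (R : realType) (w : nat).
Implicit Types (st : state R) (Q : state R -> Prop).

Definition wp P st T Q := exists t st', [/\ exec w P st t st', t <= T & Q st'].

Lemma wp_mono P st T T' Q Q' : wp P st T Q -> T <= T' -> (forall st', Q st' -> Q' st') ->
  wp P st T' Q'.
Proof.
by move=> [t [st' [e le q]]] le' qq; exists t, st'; split; [|apply: leq_trans le'|apply: qq].
Qed.

Lemma wp_skip st T Q : 0 < T -> Q st -> wp Skip st T Q.
Proof. by exists 1, st; split=> //; constructor. Qed.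

Lemma wp_wset a i e st T Q : wcost i + wcost e < T ->
  Q (set_w st a (weval w st i) (weval w st e)) -> wp (WSet a i e) st T Q.
Proof. by move=> le q; eexists _, _; split; [constructor| |exact: q]. Qed.

Lemma wp_rset a i e st T Q : wcost i + rcost e < T ->
  Q (set_r st a (weval w st i) (reval w st e)) -> wp (RSet a i e) st T Q.
Proof. by move=> le q; eexists _, _; split; [constructor| |exact: q]. Qed.

Lemma wp_seq P1 P2 st T1 T2 T Q : wp P1 st T1 (fun st1 => wp P2 st1 T2 Q) ->
  T1 + T2 <= T -> wp (Seq P1 P2) st T Q.
Proof.
move=> [t1 [st1 [e1 le1 [t2 [st2 [e2 le2 q]]]]]] le; exists (t1 + t2), st2.
by split; [apply: exec_Seq e1 e2|apply: leq_trans le; apply: leq_add|].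
Qed.

Lemma wp_if b P1 P2 st T1 T Q : wp (if beval w st b then P1 else P2) st T1 Q ->
  bcost b + T1 < T -> wp (If b P1 P2) st T Q.
Proof.
move=> [t [st' [e le q]]] lt; eexists _, st'; split; [exact: exec_If e| |exact: q].
by apply: leq_trans lt; rewrite ltnS leq_add2l.
Qed.

Definition V a := WGet a (WConst 0).

Definition loop i N body :=
  Seq (WSet i (WConst 0) (WConst 0))
    (While (WLt (V i) N)
       (Seq body (WSet i (WConst 0) (WOp WAdd (V i) (WConst 1))))).

Lemma wp_loop (Inv : nat -> state R -> Prop) i N body m T T' st :
  m < 2 ^ w -> wcost N <= 2 ->
  (forall k st v, k <= m -> Inv k st -> Inv k (set_w st i 0 v)) ->
  (forall k st, k <= m -> Inv k st -> weval w st N = m) ->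
  (forall k st, k < m -> Inv k st -> wmem st i 0 = k ->
     wp body st T (fun st' => Inv k.+1 st' /\ wmem st' i 0 = k)) ->
  10 + m * (T + 12) <= T' -> Inv 0 st -> wp (loop i N body) st T' (Inv m).
Proof.
move=> mw cN stab evN step le inv0.
(* For [w = 0] the constant 1 evaluates to 0, but then [m = 0] and the body never runs. *)
have w1 : 1 < 2 ^ w \/ m = 0 by lia.
have loopk k : k <= m -> forall st, Inv (m - k) st -> wmem st i 0 = m - k ->
    wp (While (WLt (V i) N) (Seq body (WSet i (WConst 0) (WOp WAdd (V i) (WConst 1)))))
       st (6 + k * (T + 12)) (Inv m).
  elim: k => [_|k IH km] st1 inv ctr.
    rewrite subn0 in inv ctr; exists (bcost (WLt (V i) N)).+1, st1; split=> //.
      by constructor; rewrite /= mod0n ctr (evN m) // ltnn.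
  have lt : m - k.+1 < m by lia.
  have [t [st2 [e le2 [inv2 ctr2]]]] := step _ _ lt inv ctr.
  have := stab _ _ (m - k) _ inv2; rewrite (_ : (m - k.+1).+1 = m - k); last by lia.
  move=> /(_ (leq_subr _ _)) inv3.
  have ctr3 : wmem (set_w st2 i 0 (m - k)) i 0 = m - k by rewrite /= /upd !eqxx.
  have [t' [st3 [e' le3 q]]] := IH (ltnW km) _ inv3 ctr3.
  have w1' : 1 < 2 ^ w by case: w1 => // m0; lia.
  eexists _, st3; split; [apply: exec_WhileT e'| |exact: q].
  - by rewrite /= mod0n ctr (evN (m - k.+1)) // ltnW.
  - apply: exec_Seq e _.
    have ev : weval w st2 (WOp WAdd (V i) (WConst 1)) = m - k.
      rewrite /= mod0n ctr2 (modn_small w1') modn_small; first by lia.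
      by apply: leq_ltn_trans mw; lia.
    by have := exec_WSet w i (WConst 0) (WOp WAdd (V i) (WConst 1)) st2; rewrite ev /= mod0n => h; exact: h.
  - by rewrite /=; lia.
apply: (@wp_seq _ _ _ 3 (6 + m * (T + 12))); last by lia.
apply: wp_wset => //=; rewrite mod0n.
by apply: loopk; rewrite ?subnn //=; [exact: stab|rewrite /upd !eqxx].
Qed.

Fixpoint reads a e : bool :=
  match e with
  | WConst _ => false
  | WGet a' i => (a' == a) || reads a i
  | WOp _ e1 e2 => reads a e1 || reads a e2
  end.

Lemma weval_set_w a i v e st : ~~ reads a e -> weval w (set_w st a i v) e = weval w st e.
Proof.
elim: e => [//|a' e IH|o e1 IH1 e2 IH2] /=; rewrite negb_or => /andP[h1 h2].
  by rewrite IH // /upd (negPf h1).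
by rewrite IH1 // IH2.
Qed.

(* Array 6 holds the values, 7 the successors and 8 the purchases.  Ties are
   overwritten, so that the first relaxation of a cell, whose value is then still
   0, records a successor. *)
Definition relax d s g b :=
  If (BNot (WLt (WOp WAdd (WGet 6 s) (WConst g)) (WGet 6 d)))
    (Seq (WSet 6 d (WOp WAdd (WGet 6 s) (WConst g))) (Seq (WSet 7 d s) (WSet 8 d b)))
    Skip.

End WP.

(* Points are numbered from 1 in word arrays, and from 0 in real arrays.
   Word arrays: 0 the number n of points; 1 the points sorted by row and abscissa;
   2 flags of the points already sorted; 3 the candidate of the current scan;
   4, 5, 15, 16, 17 loop counters; 6, 7, 8 the table; 9 flags of the points kept;
   10 the current cell of the trace; 11 the number of points copied; 12 the base
   B = n + 1; 13 the powers of B; 14 the number of cells; 18 the layer of a cell;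
   19 a digit of a cell.  The real array 2 holds the starting ordinates of rows. *)
Definition real_at a i := RGet a (WOp WSub i (WConst 1)).

Definition sqdiff a i j :=
  ROp RMul (ROp RSub (real_at a i) (real_at a j)) (ROp RSub (real_at a i) (real_at a j)).

Definition covers_test j v :=
  BAnd (WLt (WConst 0) (WGet 1 j)) (BAnd (WLt (WConst 0) v)
    (BNot (RLt (RCast (WConst 1))
       (RSqrt (ROp RAdd (sqdiff 0 (WGet 1 j) v) (sqdiff 1 (WGet 1 j) v)))))).

Definition lay := V 18.
Definition digit := V 19.
Definition period := WGet 13 (WConst 5).
Definition cell := V 15.
Definition digit_weight := WOp WMul digit (WGet 13 (V 16)).

Definition get_digit := WSet 19 (WConst 0) (WOp WMod (WOp WDiv cell (WGet 13 (V 16))) (V 12)).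

Definition pull_step :=
  Seq get_digit
    (Seq (If (covers_test lay digit) (relax cell (WOp WSub cell period) 1 (WConst 0)) Skip)
         (If (WLt (WConst 0) digit)
             (relax cell (WOp WSub cell digit_weight) 0 (WConst 0)) Skip)).

Definition push_step :=
  Seq get_digit
    (If (covers_test (WOp WAdd lay (WConst 1)) digit)
        (relax (WOp WSub (WOp WAdd cell period) digit_weight) cell 0 digit) Skip).

Definition dp_step :=
  Seq (WSet 18 (WConst 0) (WOp WDiv cell period))
    (Seq (If (WLt (WConst 0) (WGet 1 lay))
             (Seq (relax cell (WOp WSub cell period) 0 (WGet 1 lay)) (loop 16 (WConst 5) pull_step))
             Skip)
         (loop 16 (WConst 5) push_step)).

(** * The dynamic program on the real RAM *)

Section Program.
Variables (R : realType) (n w : nat) (s : seq (R * R)).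
Let M := n.+1 ^ 5.
Hypothesis word_bound : n.+2 ^ 7 <= 2 ^ w.

Lemma word_lt x : x < n.+2 ^ 7 -> x %% 2 ^ w = x.
Proof. by move=> lt; rewrite modn_small // (leq_trans lt). Qed.

Lemma const_lt c : c < 128 -> c < n.+2 ^ 7.
Proof. by move=> lt; apply: leq_trans lt _; rewrite -[128]/(2 ^ 7) leq_exp2r. Qed.

Lemma word_const c : c < 128 -> c %% 2 ^ w = c.
Proof. by move/const_lt/word_lt. Qed.

Definition consts := (mod0n, word_const (isT : 1 < 128), word_const (isT : 5 < 128),
  word_const (isT : 2 < 128), word_const (isT : 3 < 128), word_const (isT : 4 < 128)).

(** The bound covers the sum [c + M] that a push forms at a cell [c < n.+1 * M]. *)
Lemma cells_lt : (n.+1).+1 * M < n.+2 ^ 7.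
Proof.
have h : M <= n.+2 ^ 5 by rewrite leq_exp2r.
have p : 0 < n.+2 ^ 5 by rewrite expn_gt0.
rewrite (_ : 7 = 2 + 5) // expnD; apply: (@leq_ltn_trans (n.+2 * n.+2 ^ 5)).
  by rewrite leq_mul2l h orbT.
by rewrite ltn_mul2r p expnS expn1 ltn_Pmulr.
Qed.

Lemma le_cells x : x <= n.+2 -> x < n.+2 ^ 7.
Proof.
by move=> le; rewrite (leq_ltn_trans le) // -{1}(expn1 n.+2) ltn_exp2l.
Qed.

Record globals (st : state R) : Prop := Globals {
  g_size : wmem st 0 0 = n;
  g_base : wmem st 12 0 = n.+1;
  g_pow : forall k, k <= 5 -> wmem st 13 k = n.+1 ^ k;
  g_total : wmem st 14 0 = n.+1 * M;
  g_pt : forall i, (rmem st 0 i, rmem st 1 i) = nth (0, 0)%R s i }.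

Definition point v := nth (0, 0)%R s v.-1.

Variable own : nat -> nat.
Hypothesis own_le : forall j, own j <= n.

Let cov := covers n own point.

(** [d_le] bounds the values by cell numbers, so that adding a gain does not overflow a word. *)
Record dp_state (c f : nat) (E : edges) (st : state R) : Prop := DpState {
  d_globals : globals st;
  d_own : forall j, wmem st 1 j = own j;
  d_mark : forall v, wmem st 9 v = 0;
  d_cell : wmem st 15 0 = c;
  d_lay : wmem st 18 0 = c %/ M;
  d_rel : relaxed f E (wmem st 6) (wmem st 7) (wmem st 8);
  d_le : forall d, wmem st 6 d <= d }.

Lemma dp_state_ext c f E E' st : (forall d s g b, E d s g b <-> E' d s g b) ->
  dp_state c f E st -> dp_state c f E' st.
Proof. by move=> e [? ? ? ? ? r ?]; split=> //; apply: relaxed_ext r. Qed.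

Lemma covers_testE c f E st j v jv : dp_state c f E st ->
  weval w st j = jv -> weval w st v <= n ->
  beval w st (covers_test j v) = cov jv (weval w st v).
Proof.
move=> ds ej vn; rewrite /= ej !consts (d_own ds) /cov /covers vn andbT.
have [o0|//] := boolP (0 < own jv); have [v0|//] /= := boolP (0 < weval w st v).
have sub1 x : x <= n -> (x - 1) %% 2 ^ w = x.-1.
  by move=> xn; rewrite word_lt ?subn1 //; apply: le_cells; lia.
rewrite !sub1 // -leNgt.
have p i := g_pt (d_globals ds) i.
by rewrite /edist /point -!p /= !expr2.
Qed.

(** The expressions are evaluated again after writes to arrays 6 and 7, hence the conditions on
    [reads]. The condition [s0 + g <= d] preserves [d_le]. *)
Lemma wp_relax c f E st de se g be d b s0 : dp_state c f E st ->
  weval w st de = d -> weval w st se = s0 -> weval w st be = b ->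
  ~~ [|| reads 6 de, reads 7 de, reads 6 se, reads 6 be | reads 7 be] ->
  [&& wcost de < 20, wcost se < 20 & wcost be < 20] -> g < 128 ->
  s0 < f -> f <= d -> s0 + g <= d -> d < n.+2 ^ 7 ->
  wp w (relax de se g be) st 300 (fun st' =>
    [/\ dp_state c f (add_edge E d s0 g b) st', wmem st' 16 = wmem st 16
      & wmem st' 19 = wmem st 19]).
Proof.
move=> ds ed es eb; rewrite !negb_or => /and5P[rd6 rd7 rs6 rb6 rb7].
move=> /and3P[cd cs cb] gb sf fd sgd dw.
have le := d_le ds s0.
have ve : weval w st (WOp WAdd (WGet 6 se) (WConst g)) = wmem st 6 s0 + g.
  rewrite /= es (word_const gb) word_lt //; apply: leq_ltn_trans dw; apply: leq_trans sgd; by rewrite leq_add2r.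
apply: (@wp_if _ _ _ _ _ _ 200); last by rewrite /=; lia.
have -> : beval w st (BNot (WLt (WOp WAdd (WGet 6 se) (WConst g)) (WGet 6 de))) =
    (wmem st 6 d <= wmem st 6 s0 + g).
  by rewrite [LHS]/= -[X in ~~ (X < _)]/(weval w st (WOp WAdd (WGet 6 se) (WConst g))) ve ed -leqNgt.
case: leqP => [dle|dlt]; last first.
  by apply: wp_skip => //; split=> //; case: ds => *; split=> //; apply: relaxed_keep.
apply: (@wp_seq _ _ _ _ _ 80 120) => //; apply: wp_wset; first by rewrite /=; lia.
rewrite ve ed; apply: (@wp_seq _ _ _ _ _ 60 60) => //.
apply: wp_wset; first by rewrite /=; lia.
rewrite !weval_set_w // ed es; apply: wp_wset; first by rewrite /=; lia.
rewrite !weval_set_w // ed eb; split=> //.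
case: ds => [[g1 g2 g3 g4 g5] d1 d2 d3 d4 d5 d6]; split=> //.
  by apply: (relaxed_set sf fd d5 dle) => x; rewrite /= /upd /=.
by move=> x; rewrite /= /upd /=; case: eqP => // ->; lia.
Qed.

Lemma dp_state_set16 c f E st i v : dp_state c f E st -> dp_state c f E (set_w st 16 i v).
Proof. by case=> [[? ? ? ? ?]]. Qed.

Lemma dp_state_set19 c f E st i v : dp_state c f E st -> dp_state c f E (set_w st 19 i v).
Proof. by case=> [[? ? ? ? ?]]. Qed.

Hypothesis own0 : own 0 = 0.

Definition or_edges (E E' : edges) : edges := fun d s g b => E d s g b \/ E' d s g b.

Let B := n.+1.
Let pull_to c k := or_edges (upto n 5 own cov c) (pull n 5 own cov k c).
Let push_to c k :=
  or_edges (or_edges (upto n 5 own cov c) (pull n 5 own cov 5 c)) (push n 5 cov k c).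

Lemma cell_lt c : c < n.+1 * M -> c + M < n.+2 ^ 7.
Proof. by move=> lt; apply: leq_ltn_trans cells_lt; rewrite [X in _ <= X]mulSn addnC leq_add2l ltnW. Qed.

Lemma get_digit_wp c k f E st Q T : c < n.+1 * M -> k < 5 -> dp_state c f E st ->
  wmem st 16 0 = k ->
  (forall st', dp_state c f E st' -> wmem st' 16 0 = k -> wmem st' 19 0 = dig B k c -> Q st') ->
  50 <= T -> wp w get_digit st T Q.
Proof.
move=> cl k5 ds ek q le; apply: wp_wset; first by rewrite /=; lia.
have c7 : c < n.+2 ^ 7 by apply: leq_ltn_trans (cell_lt cl); rewrite leq_addr.
have ev : weval w st (WOp WMod (WOp WDiv cell (WGet 13 (V 16))) (V 12)) = dig B k c.
  rewrite /= !consts ek (d_cell ds) (g_pow (d_globals ds) (ltnW k5)) (g_base (d_globals ds)).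
  rewrite (@word_lt (c %/ _)) ?word_lt //; last by apply: leq_ltn_trans c7; rewrite leq_div.
  by apply: le_cells; rewrite ltnW // ltnS ltnW // ltn_mod.
by rewrite ev /= mod0n; apply: q => //=; apply: dp_state_set19.
Qed.

Lemma weightE c k f E st : c < n.+1 * M -> k < 5 -> dp_state c f E st ->
  wmem st 16 0 = k -> wmem st 19 0 = dig B k c ->
  weval w st digit_weight = dig B k c * B ^ k.
Proof.
move=> cl k5 ds ek ed; rewrite /= !consts ek ed (g_pow (d_globals ds) (ltnW k5)).
rewrite word_lt //; apply: (@leq_ltn_trans c); first exact: dig_le.
by apply: leq_ltn_trans (cell_lt cl); rewrite leq_addr.
Qed.

Lemma wp_pull_step c k st : c < n.+1 * M -> k < 5 -> 0 < own (c %/ M) ->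
  dp_state c c (pull_to c k) st -> wmem st 16 0 = k ->
  wp w pull_step st 1000 (fun st' =>
    dp_state c c (pull_to c k.+1) st' /\ wmem st' 16 0 = k).
Proof.
move=> cl k5 o ds ek; have M0 : 0 < M by rewrite expn_gt0.
have Mc : M <= c by rewrite leqNgt; apply/negP => lt; rewrite divn_small // own0 in o.
have c7 : c < n.+2 ^ 7 by apply: leq_ltn_trans (cell_lt cl); rewrite leq_addr.
apply: (@wp_seq _ _ _ _ _ 50 950) => //.
apply: (get_digit_wp cl k5 ds ek) => // {ek ds} st1 ds1 k1 d1.
apply: (@wp_seq _ _ _ _ _ 450 500) => //.
pose E1 := if cov (c %/ M) (dig B k c) then add_edge (pull_to c k) c (c - M) 1 0 else pull_to c k.
have dB : dig B k c <= n by rewrite -ltnS ltn_mod.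
have Pc st' f E : dp_state c f E st' -> weval w st' (WOp WSub cell period) = c - M.
  move=> ds'; rewrite /= !consts (d_cell ds') (g_pow (d_globals ds')) // word_lt //.
  by apply: leq_ltn_trans c7; rewrite leq_subr.
have Cc st' f E : dp_state c f E st' -> weval w st' cell = c.
  by move=> ds'; rewrite /= mod0n (d_cell ds').
have s1 : wp w (If (covers_test lay digit) (relax cell (WOp WSub cell period) 1 (WConst 0)) Skip)
   st1 450 (fun st' => [/\ dp_state c c E1 st', wmem st' 16 0 = k & wmem st' 19 0 = dig B k c]).
  apply: (@wp_if _ _ _ _ _ _ 300) => //.
  have dv : weval w st1 digit = dig B k c by rewrite /= mod0n.
  rewrite (@covers_testE c c (pull_to c k) _ _ _ (c %/ M)) ?dv //; last by rewrite /= mod0n (d_lay ds1).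
  rewrite /E1; case: ifP => cv; last by apply: wp_skip.
  have z : weval w st1 (WConst 0) = 0 by rewrite /= mod0n.
  apply: wp_mono.
  - apply: (@wp_relax c c _ st1 _ _ 1 _ c 0 (c - M) ds1 (Cc _ _ _ ds1) (Pc _ _ _ ds1) z) => //; last by lia.
    by rewrite ltn_subrL M0 (leq_trans M0).
  - by [].
  - by move=> st' [? -> ->].
apply: wp_mono s1 _ _ => // st2 [ds2 k2 d2].
apply: (@wp_if _ _ _ _ _ _ 400) => //.
have -> : beval w st2 (WLt (WConst 0) digit) = (0 < dig B k c) by rewrite /= !mod0n d2.
have fin E2 st' : dp_state c c E2 st' -> wmem st' 16 0 = k ->
    (forall d s g b, E2 d s g b <-> pull_to c k.+1 d s g b) ->
    dp_state c c (pull_to c k.+1) st' /\ wmem st' 16 0 = k.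
  by move=> ds' ek' eE; split=> //; apply: dp_state_ext ds'.
have eq1 : forall d s g b, (if 0 < dig B k c then add_edge E1 c (c - dig B k c * B ^ k) 0 0 else E1) d s g b
    <-> pull_to c k.+1 d s g b.
  move=> d s' g b; split.
    have inE1 : E1 d s' g b -> pull_to c k.+1 d s' g b.
      have sub : pull_to c k d s' g b -> pull_to c k.+1 d s' g b.
        case=> [|h]; [by left|right].
        case: h => [oo|k' oo h cv|k' oo h d0]; first exact: PullSkip.
          exact: PullUse oo (leqW h) cv.
        exact: PullDrop oo (leqW h) d0.
      rewrite /E1; case: ifP => // cv [/sub //|[-> -> -> ->]]; right.
      exact: PullUse o (ltnSn k) cv.
    case: ifP => // d0 [/inE1 //|[-> -> -> ->]]; right.
    exact: PullDrop o (ltnSn k) d0.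
  have inE1 e1 e2 e3 e4 : E1 e1 e2 e3 e4 ->
      (if 0 < dig B k c then add_edge E1 c (c - dig B k c * B ^ k) 0 0 else E1) e1 e2 e3 e4.
    by case: ifP => //; left.
  have inE0 e1 e2 e3 e4 : pull_to c k e1 e2 e3 e4 -> E1 e1 e2 e3 e4.
    by rewrite /E1; case: ifP => //; left.
  case=> [h|]; first by apply: inE1; apply: inE0; left.
  case=> [_|k' _|k' _].
  - by apply: inE1; apply: inE0; right; apply: PullSkip.
  - rewrite ltnS leq_eqVlt => /orP[/eqP->|lt] cv; last by apply: inE1; apply: inE0; right; exact: PullUse o lt cv.
    by apply: inE1; rewrite /E1 [cov _ _]cv; right.
  - rewrite ltnS leq_eqVlt => /orP[/eqP->|lt] cv; last by apply: inE1; apply: inE0; right; exact: PullDrop o lt cv.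
    by rewrite [0 < _]cv; right.
case: ifP => d0; rewrite d0 in eq1; last by apply: wp_skip => //; apply: fin eq1.
have We : weval w st2 (WOp WSub cell digit_weight) = c - dig B k c * B ^ k.
  have := weightE cl k5 ds2 k2 d2; rewrite /= => ->.
  by rewrite !consts (d_cell ds2) word_lt //; apply: leq_ltn_trans c7; rewrite leq_subr.
have z : weval w st2 (WConst 0) = 0 by rewrite /= mod0n.
apply: wp_mono.
- apply: (@wp_relax c c _ st2 _ _ 0 _ c 0 _ ds2 (Cc _ _ _ ds2) We z) => //.
    by rewrite ltn_subrL muln_gt0 d0 expn_gt0 orTb (leq_trans M0 Mc).
  by rewrite addn0 leq_subr.
- by [].
- by move=> st' [ds' e16 _]; apply: fin ds' _ eq1; rewrite e16.
Qed.

Lemma wp_push_step c k st : c < n.+1 * M -> k < 5 ->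
  dp_state c c.+1 (push_to c k) st -> wmem st 16 0 = k ->
  wp w push_step st 1000 (fun st' =>
    dp_state c c.+1 (push_to c k.+1) st' /\ wmem st' 16 0 = k).
Proof.
move=> cl k5 ds ek; have M0 : 0 < M by rewrite expn_gt0.
apply: (@wp_seq _ _ _ _ _ 50 950) => //.
apply: (get_digit_wp cl k5 ds ek) => // {ek ds} st1 ds1 k1 d1.
have dB : dig B k c <= n by rewrite -ltnS ltn_mod.
have lyn : c %/ M <= n by rewrite -ltnS ltn_divLR.
have dv : weval w st1 digit = dig B k c by rewrite /= mod0n.
apply: (@wp_if _ _ _ _ _ _ 400) => //.
rewrite (@covers_testE c c.+1 (push_to c k) _ _ _ (c %/ M).+1) ?dv //; last first.
  by rewrite /= !consts (d_lay ds1) word_lt addn1 //; apply: le_cells; lia.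
have eq1 : forall d s g b, (if cov (c %/ M).+1 (dig B k c) then
      add_edge (push_to c k) (c + M - dig B k c * B ^ k) c 0 (dig B k c) else push_to c k) d s g b
    <-> push_to c k.+1 d s g b.
  move=> d s' g b; split.
    have sub : push_to c k d s' g b -> push_to c k.+1 d s' g b.
      case=> [|h]; [by left|right].
      by case: h => k' h cv; exact: PushBuy (leqW h) cv.
    case: ifP => // cv [/sub //|[-> -> -> ->]]; right.
    exact: PushBuy (ltnSn k) cv.
  have inE0 e1 e2 e3 e4 : push_to c k e1 e2 e3 e4 ->
      (if cov (c %/ M).+1 (dig B k c) then
      add_edge (push_to c k) (c + M - dig B k c * B ^ k) c 0 (dig B k c) else push_to c k) e1 e2 e3 e4.
    by case: ifP => //; left.
  case=> [h|]; first by apply: inE0; left.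
  case=> k'; rewrite ltnS leq_eqVlt => /orP[/eqP->|lt] cv.
    by rewrite [cov _ _]cv; right.
  by apply: inE0; right; exact: PushBuy lt cv.
case: ifP => cv; rewrite cv in eq1; last first.
  by apply: wp_skip => //; split=> //; apply: dp_state_ext ds1.
have lt : dig B k c * B ^ k < M.
  apply: (@leq_trans (B * B ^ k)); last by rewrite -expnS leq_pexp2l.
  by rewrite ltn_mul2r expn_gt0 ltn_dig.
have cM : c < c + M - dig B k c * B ^ k by lia.
have d7 : c + M - dig B k c * B ^ k < n.+2 ^ 7.
  by apply: leq_ltn_trans (cell_lt cl); rewrite leq_subr.
have We : weval w st1 (WOp WSub (WOp WAdd cell period) digit_weight) = c + M - dig B k c * B ^ k.
  have := weightE cl k5 ds1 k1 d1; rewrite /= => ->.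
  rewrite !consts (d_cell ds1) (g_pow (d_globals ds1)) //.
  by rewrite (@word_lt (c + _)) ?word_lt // cell_lt.
have Ce : weval w st1 cell = c by rewrite /= mod0n (d_cell ds1).
apply: wp_mono.
- apply: (@wp_relax c c.+1 _ st1 _ _ 0 _ _ (dig B k c) c ds1 We Ce dv) => //.
  by rewrite addn0 ltnW.
- by [].
- by move=> st' [ds' e16 _]; split; [apply: dp_state_ext ds'|rewrite e16].
Qed.

(** The loop counter is itself the current cell, and the stored layer is stale between iterations.
    To survive an increment, the invariant takes the cell from the counter and speaks of the state
    in which the layer has been recomputed. *)
Definition dp_inv c st :=
  dp_state (wmem st 15 0) c (upto n 5 own cov c) (set_w st 18 0 (wmem st 15 0 %/ M)).

(** Pushes into [c] come from smaller cells and are already done. After the pulls the value of [c]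
    is therefore final, the frontier moves to [c.+1], and the pushes may use [c] as a source. *)
Lemma wp_dp_step c st : c < n.+1 * M -> dp_inv c st -> wmem st 15 0 = c ->
  wp w dp_step st (20 * 1000) (fun st' => dp_inv c.+1 st' /\ wmem st' 15 0 = c).
Proof.
move=> cl inv ec; rewrite /dp_inv ec in inv; have M0 : 0 < M by rewrite expn_gt0.
have w5 : 5 < 2 ^ w by apply: leq_trans word_bound; apply: const_lt.
have c7 : c < n.+2 ^ 7 by apply: leq_ltn_trans (cell_lt cl); rewrite leq_addr.
apply: (@wp_seq _ _ _ _ _ 50 (19 * 1000)) => //.
apply: wp_wset => //.
have gm : wmem st 13 5 = M by exact: (g_pow (d_globals inv) (leqnn 5)).
have -> : weval w st (WOp WDiv cell period) = c %/ M.
  by rewrite /= !consts ec gm word_lt //; apply: leq_ltn_trans c7; rewrite leq_div.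
rewrite /= mod0n; move: inv; move: (set_w _ _ _ _) => st1 ds1.
apply: (@wp_seq _ _ _ _ _ (9 * 1000) (8 * 1000)) => //.
have fin st' : dp_state c c (pull_to c 5) st' ->
    wp w (loop 16 (WConst 5) push_step) st' (8 * 1000) (fun st'' => dp_inv c.+1 st'' /\ wmem st'' 15 0 = c).
  move=> ds'.
  apply: (@wp_mono _ _ _ _ (8 * 1000) _ (dp_state c c.+1 (push_to c 5))) => //; last first.
    move=> st2 ds2; split; last exact: d_cell ds2.
    rewrite /dp_inv (d_cell ds2).
    have up d s' g b : push_to c 5 d s' g b <-> upto n 5 own cov c.+1 d s' g b.
      split.
        case=> [[]|].
        - by case=> c' *; [apply: (@UptoPull _ _ _ _ _ c')|apply: (@UptoPush _ _ _ _ _ c')] => //; apply: leqW.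
        - by apply: UptoPull.
        - by apply: UptoPush.
      case=> c' d0 s0 g0 b0; rewrite ltnS leq_eqVlt => /orP[/eqP->|lt] h.
      - by left; right.
      - by left; left; apply: UptoPull lt h.
      - by right.
      - by left; left; apply: UptoPush lt h.
    by case: (dp_state_ext up ds2) => [[? ? ? ? ?]].
  apply: (@wp_loop _ _ (fun k => dp_state c c.+1 (push_to c k)) _ _ _ 5 1000) => //.
  - by move=> k st2 v _; apply: dp_state_set16.
  - by move=> k st2 _ _; rewrite /= !consts.
  - by move=> k st2; apply: wp_push_step.
  - apply: dp_state_ext (_ : dp_state c c.+1 (pull_to c 5) st').
      move=> d s' g b; split; [by left|case=> // h].
      by case: h.
    by case: ds' => *; split=> //; apply: relaxed_le (leqnSn c) _.
apply: (@wp_if _ _ _ _ _ _ (8 * 1000)) => //.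
rewrite /= !consts (d_own ds1) (d_lay ds1).
case: ifP => o; last first.
  apply: wp_skip => //; apply: fin; apply: dp_state_ext ds1 => d s' g b.
  by split=> [|[]//]; [left|case=> [o'|k' o'|k' o']; rewrite o in o'].
have Mc : M <= c by rewrite leqNgt; apply/negP => lt; rewrite divn_small // own0 in o.
have Ce : weval w st1 cell = c by rewrite /= mod0n (d_cell ds1).
have Oe : weval w st1 (WGet 1 lay) = own (c %/ M) by rewrite /= mod0n (d_lay ds1) (d_own ds1).
have Pe : weval w st1 (WOp WSub cell period) = c - M.
  rewrite /= !consts (d_cell ds1) (g_pow (d_globals ds1)) // word_lt //.
  by apply: leq_ltn_trans c7; rewrite leq_subr.
apply: (@wp_seq _ _ _ _ _ 300 (7 * 1000)) => //.
apply: wp_mono.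
- apply: (@wp_relax c c _ st1 _ _ 0 _ _ _ _ ds1 Ce Pe Oe) => //.
    by rewrite ltn_subrL M0 (leq_trans M0).
  by rewrite addn0 leq_subr.
- by [].
move=> st2 [ds2 _ _].
apply: (@wp_mono _ _ _ _ (7 * 1000) _ (dp_state c c (pull_to c 5))) => //.
apply: (@wp_loop _ _ (fun k => dp_state c c (pull_to c k)) _ _ _ 5 1000) => //.
- by move=> k st3 v _; apply: dp_state_set16.
- by move=> k st3 _ _; rewrite /= !consts.
- by move=> k st3 k5 ds3; apply: wp_pull_step.
- apply: dp_state_ext ds2 => d s' g b; split.
    by case=> [|[-> -> -> ->]]; [left|right; apply: PullSkip].
  by case=> [|[_|//|//]]; [left|right].
Qed.

Definition dp := loop 15 (V 14) dp_step.

Lemma wp_dp st : dp_inv 0 st ->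
  wp w dp st (10 + n.+1 * M * (20 * 1000 + 12)) (fun st' => dp_inv (n.+1 * M) st').
Proof.
move=> inv.
have lt : n.+1 * M < n.+2 ^ 7.
  by apply: leq_ltn_trans cells_lt; rewrite [X in _ <= X]mulSn leq_addl.
apply: (@wp_loop _ _ dp_inv _ _ _ (n.+1 * M) (20 * 1000)) => //.
- by apply: leq_trans word_bound.
- by move=> k st1 v _ [[? ? ? ? ?]].
- move=> k st1 _ [[? ? ? e ?] *]; by rewrite /= mod0n.
- by move=> k st1 kl; apply: wp_dp_step.
Qed.

End Program.

(** * Sorting the points by row and abscissa *)

Section Select.
Variables (R : realType) (n : nat) (pt : nat -> R * R).

Record selected j (own used : nat -> nat) (bs : nat -> R) : Prop := Selected {
  s_used0 : 0 < used 0;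
  s_own : forall t, 0 < t <= j -> 0 < own t <= n /\ 0 < used (own t);
  s_out : forall t, ~~ (0 < t <= j) -> own t = 0;
  s_hit : forall v, 0 < v <= n -> 0 < used v -> exists2 t, 0 < t <= j & own t = v;
  s_count : count (fun v => 0 < used v) (iota 1 n) = j;
  s_mem : forall t, 0 < t <= j -> (bs t <= (pt (own t)).2 <= bs t + 2 / 3)%R;
  s_ord : forall i t, 0 < i -> i < t -> t <= j ->
    ((bs i = bs t /\ (pt (own i)).1 <= (pt (own t)).1) \/ bs i + 2 / 3 < bs t)%R;
  s_rest : forall v t, 0 < v <= n -> used v = 0 -> 0 < t <= j ->
    (bs t <= (pt v).2 /\ ((pt v).2 <= bs t + 2 / 3 -> (pt (own t)).1 <= (pt v).1))%R }.

Lemma selected_row_sorted own used bs : selected n own used bs -> row_sorted n own bs pt.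
Proof.
move=> [u0 so out hit cnt mem ord rest]; split=> //.
- by move=> j /so[].
- move=> v vn; apply: hit => //.
  have /allP/(_ v) : all (fun v => 0 < used v) (iota 1 n) by rewrite all_count size_iota cnt.
  by apply; rewrite mem_iota add1n ltnS.
Qed.

Lemma selected_unused j own used bs : selected j own used bs -> j < n ->
  exists2 v, 0 < v <= n & used v = 0.
Proof.
move=> [_ _ _ _ cnt _ _ _] jn.
have : ~~ all (fun v => 0 < used v) (iota 1 n).
  by rewrite all_count size_iota cnt neq_ltn jn.
by case/allPn=> v; rewrite mem_iota add1n ltnS -eqn0Ngt => vn /eqP; exists v.
Qed.

Lemma selected_step j own used bs b y own' used' bs' : selected j own used bs -> j < n ->
  0 < b <= n -> used b = 0 ->
  (forall v, 0 < v <= n -> used v = 0 -> (y <= (pt v).2)%R) ->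
  (forall t, t <= j -> bs' t = bs t) ->
  bs' j.+1 = (if (y < bs j)%R || (bs j + 2 / 3 < y)%R then y else bs j) ->
  ((pt b).2 <= bs' j.+1 + 2 / 3)%R ->
  (forall v, 0 < v <= n -> used v = 0 -> ((pt v).2 <= bs' j.+1 + 2 / 3)%R ->
     ((pt b).1 <= (pt v).1)%R) ->
  (exists v, [/\ 0 < v <= n, used v = 0 & y = (pt v).2]) ->
  (forall t, own' t = if t == j.+1 then b else own t) ->
  (forall v, used' v = if v == b then 1 else used v) ->
  selected j.+1 own' used' bs'.
Proof.
move=> [u0 so out hit cnt mem ord rest] jn bn ub ymin bE baseE bbase bmin [v0 [v0n uv0 yE]] ownE usedE.
have ybase : (bs' j.+1 <= y)%R by rewrite baseE; case: ifP => // /norP[]; rewrite -leNgt.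
have ub' v : used' v = 0 -> used v = 0 by rewrite usedE; case: eqP.
have mono v : 0 < used v -> 0 < used' v by rewrite usedE; case: eqP.
have old t : t <= j -> own' t = own t by rewrite ownE; case: eqP => // ->; rewrite ltnn.
have new : own' j.+1 = b by rewrite ownE eqxx.
have yb := ymin b bn ub.
have split_t t : 0 < t <= j.+1 -> 0 < t <= j \/ t = j.+1 by lia.
split.
- exact: mono.
- move=> t /split_t[tj|->]; last by rewrite new usedE eqxx.
  by rewrite old; [case: (so t tj) => ? /mono|lia].
- by move=> t tj; rewrite ownE; case: eqP => [e|_]; [lia|apply: out; lia].
- move=> v vn; rewrite usedE; case: eqP => [-> _|_]; first by exists j.+1; rewrite ?new //; lia.
  by case/(hit v vn) => t tj e; exists t; [lia|rewrite old //; lia].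
- have eqc := count_predUI (pred1 b) (fun v => 0 < used v) (iota 1 n).
  have -> : count (fun v => 0 < used' v) (iota 1 n) = count (predU (pred1 b) (fun v => 0 < used v)) (iota 1 n).
    by apply: eq_count => v /=; rewrite usedE; case: eqP.
  have c0 : count (predI (pred1 b) (fun v => 0 < used v)) (iota 1 n) = 0.
    apply/eqP; rewrite eqn0Ngt -has_count; apply/hasPn => v _ /=.
    by apply/negP => /andP[/eqP ->]; rewrite ub.
  have c1 : count (pred1 b) (iota 1 n) = 1.
    by rewrite count_uniq_mem ?iota_uniq // mem_iota add1n ltnS bn.
  by rewrite c0 c1 cnt addn0 add1n in eqc.
- move=> t /split_t[tj|->]; first by rewrite old ?bE; [apply: mem| |]; lia.
  by rewrite new bbase andbT (le_trans ybase).
- move=> i t i0 it /[1!leq_eqVlt] /orP[/eqP e|tj]; last first.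
    by rewrite !old ?bE; [apply: ord| | | |]; lia.
  have ij : 0 < i <= j by lia.
  rewrite e new (old i) ?(bE i); try lia.
  have [r1 r2] := rest _ _ bn ub ij.
  have le_ij : (bs i = bs j \/ bs i + 2 / 3 < bs j)%R.
    move: (ij); rewrite (leq_eqVlt i j) => /andP[_ /orP[/eqP->|lt]]; first by left.
    by case: (ord i j i0 lt (leqnn j)) => [[-> _]|]; [left|right].
  have jj : 0 < j <= j by lia.
  have [yj _] := rest _ _ v0n uv0 jj; rewrite -yE in yj.
  move: baseE; rewrite ltNge yj /=; case: ltP => [lt baseE|ge baseE].
    by right; rewrite baseE; case: le_ij; lra.
  case: le_ij => e'; [left|by right; rewrite baseE].
  by rewrite baseE -e'; split=> //; apply: r2; rewrite e' -baseE.
- move=> v t vn /[dup] uv' /ub' uv /split_t[tj|->].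
    by rewrite old ?bE; [apply: rest| |]; lia.
  by rewrite new; split; [apply: le_trans ybase (ymin _ vn uv)|apply: bmin].
Qed.

End Select.

Definition chosen := V 3.
Definition succ e := WOp WAdd e (WConst 1).
Definition unused e := WLt (WGet 2 e) (WConst 1).

(* Every scan starts from a candidate that is already used (initially the
   inexistent point 0, which is flagged as used) or already valid, so that no
   special case is needed for an empty candidate. *)
Definition scan cond := loop 5 (V 0) (If cond (WSet 3 (WConst 0) (succ (V 5))) Skip).

Definition lowest := BAnd (unused (succ (V 5)))
  (BNot (BAnd (unused chosen) (BNot (RLt (RGet 1 (V 5)) (real_at 1 chosen))))).

Definition row_height := ROp RDiv (RCast (WConst 2)) (RCast (WConst 3)).

Definition leftmost := BAnd (unused (succ (V 5)))
  (BAnd (BNot (RLt (ROp RAdd (RGet 2 (succ (V 4))) row_height) (RGet 1 (V 5))))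
        (RLt (RGet 0 (V 5)) (real_at 0 chosen))).

(* Row starts increase, so the first comparison only matters for the first point,
   which is compared to the initial value 0. *)
Definition new_row := BNot (BAnd (BNot (RLt (real_at 1 chosen) (RGet 2 (V 4))))
  (BNot (RLt (ROp RAdd (RGet 2 (V 4)) row_height) (real_at 1 chosen)))).

Definition select_step :=
  Seq (scan lowest)
    (Seq (If new_row (RSet 2 (succ (V 4)) (real_at 1 chosen)) (RSet 2 (succ (V 4)) (RGet 2 (V 4))))
      (Seq (scan leftmost)
        (Seq (WSet 1 (succ (V 4)) chosen) (WSet 2 chosen (WConst 1))))).

Definition select := loop 4 (V 0) select_step.

Definition next_power k := WSet 13 (WConst k.+1) (WOp WMul (WGet 13 (WConst k)) (V 12)).

Definition setup :=
  Seq (WSet 12 (WConst 0) (succ (V 0)))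
    (Seq (WSet 13 (WConst 0) (WConst 1))
      (Seq (next_power 0) (Seq (next_power 1) (Seq (next_power 2) (Seq (next_power 3)
        (Seq (next_power 4)
          (Seq (WSet 14 (WConst 0) (WOp WMul (V 12) period)) (WSet 2 (WConst 0) (WConst 1))))))))).

(** * Execution of the selection *)

Section Select.
Variables (R : realType) (n w : nat) (s : seq (R * R)).
Let M := n.+1 ^ 5.
Hypothesis word_bound : n.+2 ^ 7 <= 2 ^ w.
Let pt := point s.
Let consts := consts word_bound.
Let word_lt := word_lt word_bound.

Record same (st0 st : state R) : Prop := Same {
  same_w : forall a i, a != 3 -> a != 5 -> wmem st a i = wmem st0 a i;
  same_r : forall a i, rmem st a i = rmem st0 a i }.

Lemma wp_scan cond (I : nat -> nat -> Prop) st0 T : wmem st0 0 0 = n ->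
  bcost cond <= 60 -> 10 + n * 112 <= T ->
  (forall i b st, i < n -> same st0 st -> wmem st 3 0 = b -> wmem st 5 0 = i -> I i b ->
     I i.+1 (if beval w st cond then i.+1 else b)) ->
  I 0 (wmem st0 3 0) ->
  wp w (scan cond) st0 T (fun st => same st0 st /\ I n (wmem st 3 0)).
Proof.
move=> en cb le step i0.
have nw : n < 2 ^ w by apply: leq_trans word_bound; apply: le_cells; lia.
apply: (@wp_loop _ _ (fun i st => same st0 st /\ I i (wmem st 3 0)) _ _ _ n 100) => //.
- move=> k st v _ [[sw sr] inv]; split=> //; split=> // a i a3 a5.
  by rewrite /= /upd (negPf a5) sw.
- by move=> k st _ [[sw _] _]; rewrite /= mod0n sw.
move=> k st kn [ss inv] ek; have h := step k _ st kn ss erefl ek inv.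
have ev : weval w st (succ (V 5)) = k.+1.
  by rewrite /= !consts ek word_lt addn1 //; apply: le_cells; lia.
apply: (@wp_if _ _ _ _ _ _ 20); last by lia.
move: h; case: ifP => c h; last by apply: wp_skip.
apply: wp_wset => //; rewrite ev /= mod0n; split=> //; split=> //.
by case: ss => sw sr; split=> // a i a3 a5; rewrite /= /upd (negPf a3) sw.
Qed.

(** [i_clean] keeps arrays 6 to 9 at zero for the dynamic program. By [i_best] the candidate left
    over from one step is a used point, from which the next scan may start. *)
Record sel_inv (j : nat) (st : state R) : Prop := SelInv {
  i_globals : globals n s st;
  i_clean : forall a i, 5 < a < 10 -> wmem st a i = 0;
  i_best : wmem st 3 0 <= n /\ 0 < wmem st 2 (wmem st 3 0);
  i_sel : selected n pt j (wmem st 1) (wmem st 2) (rmem st 2) }.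

Lemma pt_coord st v : globals n s st -> (rmem st 0 v.-1 = (pt v).1) /\ (rmem st 1 v.-1 = (pt v).2).
Proof. by move=> g; have := g_pt g v.-1; rewrite /pt /point => <-. Qed.

Lemma wp_select_step j st : j < n -> sel_inv j st -> wmem st 4 0 = j ->
  wp w select_step st (1000 + n * 224) (fun st' => sel_inv j.+1 st' /\ wmem st' 4 0 = j).
Proof.
move=> jn [gl cl [ble ub] sel] ej.
have small x : x <= n.+2 -> x %% 2 ^ w = x by move=> h; apply/word_lt/le_cells.
have n2 : n <= n.+2 by lia.
have n1 : n < n.+2 by lia.
have sub1 x : x <= n -> (x - 1) %% 2 ^ w = x.-1 by move=> h; rewrite subn1 small; lia.
have add1 x : x < n -> (x + 1) %% 2 ^ w = x.+1 by move=> h; rewrite addn1 small; lia.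
have yE v : rmem st 1 v.-1 = (pt v).2 by case: (pt_coord v gl).
have xE v : rmem st 0 v.-1 = (pt v).1 by case: (pt_coord v gl).
pose U v := wmem st 2 v = 0; pose y v := (pt v).2; pose x v := (pt v).1.
apply: (@wp_seq _ _ _ _ _ (10 + n * 112) (900 + n * 112)); last by lia.
pose I1 i b := [/\ b <= n, forall v, 0 < v <= i -> U v -> U b /\ (y b <= y v)%R & U b -> 0 < b <= i].
apply: wp_mono (wp_scan (I := I1) _ _ (leqnn _) _ _) (leqnn _) _ => //.
- exact: g_size gl.
- move=> i b st1 lt [sw sr] eb ei [bn low pos].
  have -> : beval w st1 lowest =
      (wmem st 2 i.+1 == 0) && ((wmem st 2 b != 0) || (y i.+1 < y b)%R).
    rewrite /= !consts eb ei add1 // sub1 // !sw // !sr !ltnS !leqn0.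
    by rewrite negb_and negbK -[rmem st 1 i]/(rmem st 1 i.+1.-1) !yE.
  case: ifP => [/andP[/eqP Ui c]|c].
    split=> // [v vi Uv|_]; last by rewrite /= leqnn.
    split=> //; have [->//|ne] := eqVneq v i.+1.
    have [Ub yb] := low v ltac:(lia) Uv.
    by case/orP: c => [|/ltW h]; [rewrite Ub|apply: le_trans yb].
  split=> // [v vi Uv|/pos]; last by lia.
  have [e|ne] := eqVneq v i.+1; last by apply: low => //; lia.
  move: c; rewrite -e [_ == 0](introT eqP Uv) /= => /norP[/negPn/eqP Ub].
  by rewrite -leNgt => h; split.
- by split=> // [v|Ub]; [lia|rewrite Ub in ub].
move=> st1 [ss1 [bn low pos]]; have [sw sr] := ss1.
set b1 := wmem st1 3 0 in bn low pos.
have [v0 v0n Uv0] := selected_unused sel jn.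
have [Ub _] := low v0 v0n Uv0; have b1n := pos Ub.
pose bsn := if (y b1 < rmem st 2 j)%R || (rmem st 2 j + 2 / 3 < y b1)%R then y b1 else rmem st 2 j.
apply: (@wp_seq _ _ _ _ _ 100 (800 + n * 112)); last by lia.
apply: (@wp_mono _ _ _ _ 100 _ (fun st2 => st2 = set_r st1 2 j.+1 bsn)) => //.
  apply: (@wp_if _ _ _ _ _ _ 50) => //.
  have -> : beval w st1 new_row = (y b1 < rmem st 2 j)%R || (rmem st 2 j + 2 / 3 < y b1)%R.
    by rewrite /= !consts -/b1 !sw // ej sub1 // !sr yE negb_and !negbK.
  rewrite /bsn; case: ifP => _; apply: wp_rset => //.
    by rewrite /= !consts sub1 // -/b1 sw // ej add1 // sr yE.
  by rewrite /= !consts sw // ej add1 // sr.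
move=> _ ->; apply: (@wp_seq _ _ _ _ _ (10 + n * 112) 700); last by lia.
set st2 := set_r _ _ _ _.
have ybsn : (bsn <= y b1 <= bsn + 2 / 3)%R.
  rewrite /bsn; case: ifP => [_|/norP[]]; first by apply/andP; split; lra.
  by rewrite -!leNgt => -> ->.
pose I2 i b := [/\ 0 < b <= n, U b, (y b <= bsn + 2 / 3)%R &
  forall v, 0 < v <= i -> U v -> (y v <= bsn + 2 / 3)%R -> (x b <= x v)%R].
apply: wp_mono (wp_scan (I := I2) _ _ (leqnn _) _ _) (leqnn _) _ => //.
- by rewrite /= sw // (g_size gl).
- move=> i b st3 lt [sw3 sr3] eb ei [bn' Ub' yb' low'].
  have -> : beval w st3 leftmost =
      [&& wmem st 2 i.+1 == 0, (y i.+1 <= bsn + 2 / 3)%R & (x i.+1 < x b)%R].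
    rewrite /= !consts eb ei add1 // sub1 ?(andP bn').2 // !sw3 // !sr3 /= !sw // ej add1 //.
    rewrite /upd /= eqxx !sr -leNgt ltnS leqn0.
    by rewrite -[rmem st 1 i]/(rmem st 1 i.+1.-1) -[rmem st 0 i]/(rmem st 0 i.+1.-1) !yE !xE.
  case: ifP => [/and3P[/eqP Ui yi xi]|c].
    split=> // v vi Uv yv; have [->//|ne] := eqVneq v i.+1.
    by apply: le_trans (ltW xi) _; apply: low' => //; lia.
  split=> // v vi Uv yv; have [e|ne] := eqVneq v i.+1; last by apply: low' => //; lia.
  by move: c; rewrite -e [_ == 0](introT eqP Uv) yv /= => /negbT; rewrite -leNgt.
- by split=> //; [case/andP: ybsn|lia].
move=> st3 [[sw3 sr3] [bn' Ub' yb' low']].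
set b := wmem st3 3 0 in bn' Ub' yb' low'.
have e4 : wmem st3 4 0 = j by rewrite sw3 //= sw.
apply: (@wp_seq _ _ _ _ _ 100 100) => //; apply: wp_wset => //; apply: wp_wset => //.
rewrite /= !consts /upd /= e4 add1 // -/b; split=> //.
split.
- case: gl => g0 g1 g2 g3 g4; split=> //=; rewrite /upd /=.
  + by rewrite sw3 //= sw.
  + by rewrite sw3 //= sw.
  + by move=> k k5; rewrite sw3 //= sw // g2.
  + by rewrite sw3 //= sw.
  + by move=> i; rewrite !sr3 /= /upd /= !sr.
- by move=> a i /andP[a5 a10]; rewrite /= /upd /= !(gtn_eqF (ltn_trans _ a5)) //= sw3 ?sw ?cl ?a5; lia.
- by rewrite /= /upd /= -/b eqxx; case/andP: bn'.
- have bsE : rmem (set_w (set_w st3 1 j.+1 b) 2 b 1) 2 j.+1 = bsn by rewrite /= sr3 /= /upd /= eqxx.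
  apply: (@selected_step _ _ _ _ _ _ _ b (y b1) _ _ _ sel jn); rewrite ?bsE //.
  + by move=> v vn Uv; case: (low v vn Uv).
  + by move=> t tj; rewrite /= sr3 /= /upd /= sr; case: eqP => // e; lia.
  + by exists b1; split=> //; lia.
  + by move=> t; rewrite /= /upd /= sw3 //= sw.
  + by move=> v; rewrite /= /upd /= sw3 //= sw.
Qed.

Lemma wp_select st : sel_inv 0 st ->
  wp w select st (10 + n * (1012 + n * 224)) (sel_inv n).
Proof.
move=> inv; have nw : n < 2 ^ w by apply: leq_trans word_bound; apply: le_cells; lia.
apply: (@wp_loop _ _ sel_inv _ _ _ n (1000 + n * 224)) => //.
- move=> k st1 v _ [[? ? ? ? ?] cl [? ?] ?]; split=> // a i ab; rewrite /= /upd.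
  by rewrite gtn_eqF ?cl //; lia.
- by move=> k st1 _ [[e ? ? ? ?] *]; rewrite /= mod0n.
- by move=> k st1; apply: wp_select_step.
- by rewrite leq_add2l leq_mul2l; apply/orP; right; lia.
Qed.

Lemma wp_setup : size s = n -> wp w setup (input s) 200 (sel_inv 0).
Proof.
move=> sn.
have pow k : k <= 5 -> n.+1 ^ k %% 2 ^ w = n.+1 ^ k.
  move=> k5; apply: word_lt; apply: (@leq_ltn_trans (n.+2 ^ 5)); last by rewrite ltn_exp2l.
  by apply: (@leq_trans (n.+1 ^ 5)); rewrite ?leq_pexp2l ?leq_exp2r.
have tot : (n.+1 * n.+1 ^ 5) %% 2 ^ w = n.+1 * n.+1 ^ 5.
  by apply/word_lt/(leq_ltn_trans _ (cells_lt n)); rewrite [X in _ <= X]mulSn leq_addl.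
have n1 : n.+1 %% 2 ^ w = n.+1 by apply/word_lt/le_cells; lia.
have np k (st : state R) T Q : k < 5 -> 20 <= T -> wmem st 13 k = n.+1 ^ k -> wmem st 12 0 = n.+1 ->
    Q (set_w st 13 k.+1 (n.+1 ^ k.+1)) -> wp w (next_power k) st T Q.
  move=> k5 T20 e13 e12 q; apply: wp_wset; first by rewrite /=; lia.
  have ks x : x <= 5 -> x %% 2 ^ w = x.
    by move=> x5; apply: (word_const word_bound); apply: leq_ltn_trans x5 _.
  have k5' := ltnW k5; rewrite /= !consts (ks k) // (ks k.+1) // e13 e12 -expnSr pow //.
apply: (@wp_seq _ _ _ _ _ 20 180) => //; apply: wp_wset => //.
rewrite /= !consts sn addn1 n1.
apply: (@wp_seq _ _ _ _ _ 20 160) => //; apply: wp_wset => //.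
rewrite /= !consts.
apply: (@wp_seq _ _ _ _ _ 20 140) => //; apply: (np) => //.
apply: (@wp_seq _ _ _ _ _ 20 120) => //; apply: (np) => //.
apply: (@wp_seq _ _ _ _ _ 20 100) => //; apply: (np) => //.
apply: (@wp_seq _ _ _ _ _ 20 80) => //; apply: (np) => //.
apply: (@wp_seq _ _ _ _ _ 20 60) => //; apply: (np) => //.
apply: (@wp_seq _ _ _ _ _ 20 40) => //; apply: wp_wset => //.
set st5 := set_w _ 13 5 _.
have -> : weval w st5 (WOp WMul (V 12) period) = n.+1 * n.+1 ^ 5.
  by rewrite /= !consts /upd /= tot.
rewrite [weval w st5 _]/= mod0n; apply: wp_wset => //.
rewrite [weval w _ (WConst 0)]/= [weval w _ (WConst 1)]/= !consts /st5.
split.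
- split=> //=.
  + by do 6 (case=> //); move=> k; rewrite /upd /=.
  + by move=> i; rewrite -surjective_pairing.
- by move=> a i; move: a; do 10?[case=> //].
- by rewrite /= /upd /=.
split=> //=.
- by move=> t t0; exfalso; lia.
- by move=> v v0; rewrite /upd /=; case: eqP => [e|//]; exfalso; lia.
- apply/eqP; rewrite eqn0Ngt -has_count; apply/hasPn => v; rewrite mem_iota /upd /=.
  by case: eqP => // ->.
- by move=> t t0; exfalso; lia.
- by move=> i t t0 it tj; exfalso; lia.
- by move=> v t _ _ t0; exfalso; lia.
Qed.

End Select.

(** * Reading off the purchases and writing the output *)

Definition current := V 10.
Definition bought := WGet 8 current.

Definition trace_step :=
  If (BNot (WLt current period))
    (Seq (If (WLt (WConst 0) bought) (WSet 9 bought (WConst 1)) Skip)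
         (WSet 10 (WConst 0) (WGet 7 current)))
    Skip.

(* The current cell decreases, so a loop over the number of cells is long enough. *)
Definition trace :=
  Seq (WSet 10 (WConst 0) (WOp WMul (V 0) period)) (loop 17 (V 14) trace_step).

Definition copy_step :=
  If (WLt (WConst 0) (WGet 9 (succ (V 5))))
    (Seq (RSet 0 (V 11) (RGet 0 (V 5)))
      (Seq (RSet 1 (V 11) (RGet 1 (V 5))) (WSet 11 (WConst 0) (succ (V 11)))))
    Skip.

Definition copy :=
  Seq (WSet 11 (WConst 0) (WConst 0))
    (Seq (loop 5 (V 0) copy_step) (WSet 0 (WConst 0) (V 11))).

Definition program := Seq setup (Seq select (Seq dp (Seq trace copy))).

Lemma traced_ext n m cov val c mark mark' : mark =1 mark' ->
  traced n m cov val c mark -> traced n m cov val c mark'.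
Proof.
move=> e [c1 c2 c3 c4]; split=> //.
- by move=> k km d0; rewrite -e; apply: c2.
- by move=> j jn; case: (c3 j jn) => v v0 cv; exists v; rewrite // -e.
- rewrite /marked -(eq_count (a1 := fun v => 0 < mark v)) // => v; by rewrite e.
Qed.

Section Trace.
Variables (R : realType) (n w : nat) (s : seq (R * R)).
Let M := n.+1 ^ 5.
Hypothesis word_bound : n.+2 ^ 7 <= 2 ^ w.
Let consts := consts word_bound.
Let word_lt := word_lt word_bound.

Section Run.
Variables (own : nat -> nat) (cov : nat -> nat -> bool) (val nxt buy : nat -> nat).
Hypothesis step : forall cur mark, M <= cur -> traced n 5 cov val cur mark ->
  nxt cur < cur /\ traced n 5 cov val (nxt cur) (add_mark mark (buy cur)).

Record trace_inv (t : nat) (st : state R) : Prop := TraceInv {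
  t_globals : globals n s st;
  t_nxt : forall c, wmem st 7 c = nxt c;
  t_buy : forall c, wmem st 8 c = buy c;
  t_traced : traced n 5 cov val (wmem st 10 0) (wmem st 9);
  t_fuel : wmem st 10 0 < M \/ wmem st 10 0 + t <= n * M }.

Lemma wp_trace_step t st : trace_inv t st -> wmem st 17 0 = t ->
  wp w trace_step st 200 (fun st' => trace_inv t.+1 st' /\ wmem st' 17 0 = t).
Proof.
move=> [g nx bu tr fu] et; set cur := wmem st 10 0 in tr fu.
apply: (@wp_if _ _ _ _ _ _ 150) => //.
have -> : beval w st (BNot (WLt current period)) = (M <= cur).
  by rewrite /= !consts (g_pow g) // -leqNgt.
case: (leqP M cur) => [Mc|cM]; last by apply: wp_skip => //; split=> //; split=> //; left.
have [lt tr'] := step Mc tr.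
apply: (@wp_seq _ _ _ _ _ 50 50) => //.
apply: (@wp_mono _ _ _ _ 50 _ (fun st1 => st1 = if 0 < buy cur then set_w st 9 (buy cur) 1 else st)) => //.
  apply: (@wp_if _ _ _ _ _ _ 20) => //.
  rewrite /= !mod0n bu -/cur; case: ifP => b; last by apply: wp_skip.
  by apply: wp_wset => //; rewrite /= !consts bu.
move=> _ ->; apply: wp_wset => //.
have fu' : nxt cur < M \/ nxt cur + t.+1 <= n * M.
  by case: fu => [|le]; [rewrite ltnNge Mc|right; lia].
case: ifP => b; rewrite /= mod0n /upd /= nx -/cur; split=> //.
  split=> //=; first by case: g.
  by apply: traced_ext tr' => v; rewrite /add_mark b.
split=> //=; first by case: g.
by apply: traced_ext tr' => v; rewrite /add_mark b.
Qed.

Lemma wp_trace st : globals n s st -> wmem st 7 =1 nxt -> wmem st 8 =1 buy ->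
  (forall v, wmem st 9 v = 0) -> traced n 5 cov val (n * M) (fun=> 0) ->
  wp w trace st (20 + n.+1 * M * 212) (fun st' =>
    [/\ globals n s st', traced n 5 cov val (wmem st' 10 0) (wmem st' 9)
      & wmem st' 10 0 < M]).
Proof.
move=> g nx bu mk tr; have M0 : 0 < M by rewrite expn_gt0.
have lt : n.+1 * M < n.+2 ^ 7.
  by apply: leq_ltn_trans (cells_lt n); rewrite [X in _ <= X]mulSn leq_addl.
apply: (@wp_seq _ _ _ _ _ 10 (10 + n.+1 * M * 212)) => //; apply: wp_wset => //.
have -> : weval w st (WOp WMul (V 0) period) = n * M.
  rewrite /= !consts (g_size g) (g_pow g) // word_lt //.
  by apply: leq_ltn_trans lt; rewrite leq_mul2r leqnSn orbT.
rewrite [weval w st _]/= mod0n.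
apply: (@wp_mono _ _ _ _ (10 + n.+1 * M * 212) _ (trace_inv (n.+1 * M))) => //; last first.
  move=> st' [g' _ _ tr' fu]; split=> //; case: fu => //.
  by rewrite mulSn; lia.
apply: (@wp_loop _ _ trace_inv _ _ _ (n.+1 * M) 200) => //.
- by apply: leq_trans word_bound.
- by move=> k st1 v _ [[? ? ? ? ?] ? ? ? ?].
- by move=> k st1 _ [[? ? ? e ?] *]; rewrite /= mod0n.
- by move=> k st1 _; apply: wp_trace_step.
- split=> //=; first by case: g.
    by apply: traced_ext tr => v; rewrite /= /upd /= mk.
  by right; rewrite /upd /= addn0.
Qed.

End Run.

Section Copy.
Variable mark : nat -> nat.

Definition kept i := [seq nth (0, 0)%R s t | t <- iota 0 i & 0 < mark t.+1].

Lemma keptS i : kept i.+1 = kept i ++ (if 0 < mark i.+1 then [:: nth (0, 0)%R s i] else [::]).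
Proof.
have := iotaD 0 i 1; rewrite addn1 /kept => ->.
by rewrite filter_cat map_cat /= add0n; case: ifP.
Qed.

Lemma size_kept i : size (kept i) <= i.
Proof. by rewrite size_map size_filter (leq_trans (count_size _ _)) ?size_iota. Qed.

(** The copy is made in place: by [size_kept] the write position never passes the read position, so
    the points from [i] on are still intact. *)
Record copy_inv i (st : state R) : Prop := CopyInv {
  c_size : wmem st 0 0 = n;
  c_mark : forall v, wmem st 9 v = mark v;
  c_count : wmem st 11 0 = size (kept i);
  c_done : forall t, t < size (kept i) -> (rmem st 0 t, rmem st 1 t) = nth (0, 0)%R (kept i) t;
  c_todo : forall t, i <= t -> (rmem st 0 t, rmem st 1 t) = nth (0, 0)%R s t }.

Lemma wp_copy_step i st : i < n -> copy_inv i st -> wmem st 5 0 = i ->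
  wp w copy_step st 100 (fun st' => copy_inv i.+1 st' /\ wmem st' 5 0 = i).
Proof.
move=> lt [e0 e9 e11 dn td] e5; have sk := size_kept i.
have small x : x < n -> (x + 1) %% 2 ^ w = x.+1.
  by move=> h; rewrite addn1; apply/word_lt/le_cells; lia.
apply: (@wp_if _ _ _ _ _ _ 80) => //.
have -> : beval w st (WLt (WConst 0) (WGet 9 (succ (V 5)))) = (0 < mark i.+1).
  by rewrite /= !consts e5 small // e9.
case: ifP => mi; last first.
  apply: wp_skip => //; split=> //.
  have ke : kept i.+1 = kept i by rewrite keptS mi cats0.
  by split; rewrite ?ke // => t it; apply: td; lia.
have ke : kept i.+1 = rcons (kept i) (nth (0, 0)%R s i) by rewrite keptS mi cats1.
apply: (@wp_seq _ _ _ _ _ 20 60) => //; apply: wp_rset => //.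
apply: (@wp_seq _ _ _ _ _ 20 40) => //; apply: wp_rset => //; apply: wp_wset => //.
rewrite /= !consts e11 e5 small; last by apply: leq_ltn_trans lt.
have [tx ty] : rmem st 0 i = (nth (0, 0)%R s i).1 /\ rmem st 1 i = (nth (0, 0)%R s i).2.
  by rewrite -td.
split=> //; split=> //=.
- by rewrite /upd /= ke size_rcons.
- move=> t; rewrite ke size_rcons ltnS nth_rcons /upd /= leq_eqVlt => /orP[/eqP->|tl].
    by rewrite eqxx ltnn tx ty -surjective_pairing.
  by rewrite tl (ltn_eqF tl) dn.
- move=> t it; rewrite /upd /= gtn_eqF ?(leq_ltn_trans sk it) //.
  by apply: td; apply: ltnW.
Qed.

Lemma wp_copy st : globals n s st -> wmem st 9 =1 mark ->
  wp w copy st (30 + n * 112) (fun st' => output st' = kept n).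
Proof.
move=> g mk; have nw : n < 2 ^ w by apply: leq_trans word_bound; apply: le_cells; lia.
apply: (@wp_seq _ _ _ _ _ 10 (20 + n * 112)) => //; apply: wp_wset => //.
apply: (@wp_seq _ _ _ _ _ (10 + n * 112) 10); last by lia.
apply: (@wp_mono _ _ _ _ (10 + n * 112) _ (copy_inv n)) => //; last first.
  move=> st' [e0 e9 e11 dn td]; apply: wp_wset => //.
  rewrite /output /= !mod0n /upd /= e11.
  apply: (@eq_from_nth _ (0, 0)%R); rewrite size_map size_iota // => t tl.
  by rewrite (nth_map 0) ?size_iota // nth_iota // add0n dn.
apply: (@wp_loop _ _ copy_inv _ _ _ n 100) => //.
- by move=> k st1 v _ [? ? ? ? ?].
- by move=> k st1 _ [e *]; rewrite /= mod0n.
- by move=> k st1; apply: wp_copy_step.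
- split=> //=; first exact: g_size g.
    by rewrite !mod0n /upd.
  by move=> t _; apply: g_pt g t.
Qed.

End Copy.
End Trace.

(** * Correctness *)

Lemma word_size_bound n : (n.+2 ^ 7 <= 2 ^ word_size 7 n)%N.
Proof. by rewrite /word_size mulnC expnM leq_exp2r // up_logP. Qed.

Section Correctness.
Variables (R : realType) (n : nat) (s : seq (R * R)).
Hypothesis size_s : size s = n.
Let w := word_size 7 n.
Let M := n.+1 ^ 5.
Let wb : n.+2 ^ 7 <= 2 ^ w := word_size_bound n.

(** Optimality is stated against all assignments of depth at most five, whatever the rows in their
    labels; [row_assignment] supplies the one to compare with. *)
Lemma program_correct : wp w program (input s) ((30 * 1000) * n.+1 ^ 6) (fun st =>
  exists own bs mark, [/\ row_sorted n own bs (point s), output st = kept s mark n,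
    forall j, 0 < j <= n -> exists2 v, 0 < mark v & covers n own (point s) j v
    & forall (a : 'I_n -> 'I_n.+1 * 'I_n.+1),
        (forall i : 'I_n, covers n own (point s) i.+1 (a i).2) ->
        (forall g, #|active a g| <= 5) -> marked n mark <= #|labels a|]).
Proof.
have pw k : k <= 6 -> n.+1 ^ k <= n.+1 ^ 6 by move=> k6; rewrite leq_pexp2l.
have p1 := pw 1 isT; have p2 := pw 2 isT; rewrite expn1 in p1.
have nn : n * (n * 224) <= 224 * n.+1 ^ 6.
  apply: (@leq_trans (224 * n.+1 ^ 2)); last by rewrite leq_mul2l p2 orbT.
  by rewrite expnS expn1; nia.
have nM : n.+1 * M = n.+1 ^ 6 by rewrite /M -expnS.
have p0 : 0 < n.+1 ^ 6 by rewrite expn_gt0.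
(* With the power replaced by a variable, the time budgets become linear. *)
move: nn nM p0 p1 {p2 pw}; move: (n.+1 ^ 6) => X nn nM p0 p1.
apply: (@wp_seq _ _ _ _ _ 200 ((29 * 1000 + 800) * X)); last by lia.
apply: wp_mono (wp_setup wb size_s) (leqnn _) _ => st0 inv0.
apply: (@wp_seq _ _ _ _ _ (10 + n * (1012 + n * 224)) (28 * 1000 * X)); last first.
  by rewrite mulnDr; move: nn; move: (n * (n * 224)) => y nn; lia.
apply: wp_mono (wp_select wb inv0) (leqnn _) _ => st1 [g1 cl1 _ sel1].
have rs := selected_row_sorted sel1.
set own := wmem st1 1 in rs; set bs := rmem st1 2 in rs.
have own0 : own 0 = 0 by apply: (own_out rs).
have own_le j : own j <= n.
  have [jn|jn] := boolP (0 < j <= n); first by case/andP: (own_range rs jn).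
  by rewrite (own_out rs).
have own_gt0 j : 0 < j <= n -> 0 < own j by move=> jn; case/andP: (own_range rs jn).
set cov := covers n own (point s).
have own_in j : 0 < own j -> 0 < j <= n.
  by move=> o; apply: contraLR o => jn; rewrite (own_out rs).
have cov_own j : 0 < own j -> cov j (own j).
  move=> o; rewrite /cov /covers o own_le /= edist_le1 !subrr expr0n /= addr0.
  exact: ler01.
have cov_bound j v : cov j v -> 0 < v <= n /\ 0 < j <= n.
  by case/and3P=> o vn _; split=> //; apply: own_in.
have inv1 : dp_inv n s own 0 st1.
  split=> //=; try by case: g1.
  - by move=> v; rewrite /upd /= cl1.
  - split=> [d s' g b|d]; last by right; rewrite /upd /= cl1.
    by case=> c; rewrite ltn0.
  - by move=> d; rewrite /upd /= cl1.
apply: (@wp_seq _ _ _ _ _ (10 + n.+1 * M * (20 * 1000 + 12)) (7 * 1000 * X)); last by rewrite nM; lia.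
apply: wp_mono (wp_dp wb own_le own0 inv1) (leqnn _) _ => st2.
rewrite /dp_inv; case=> g2 _ mk2 _ _ rel _.
set val := wmem _ 6 in rel; set nxt := wmem _ 7 in rel; set buy := wmem _ 8 in rel.
have g2' : globals n s st2 by case: g2.
have step := traced_step own0 own_gt0 cov_own cov_bound rel.
apply: (@wp_seq _ _ _ _ _ (20 + n.+1 * M * 212) (6 * 1000 * X)); last by rewrite nM; lia.
have tw := wp_trace wb step g2' (fun=> erefl) (fun=> erefl) mk2 (traced0 n 5 cov val).
apply: wp_mono tw (leqnn _) _.
move=> st3 [g3 [cl ds cs le] curM]; set mark := wmem st3 9 in ds cs le.
apply: wp_mono (wp_copy wb g3 (fun=> erefl)) _ _; first by lia.
move=> st4 out; exists own, bs, mark; split=> //.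
  by move=> j jn; apply: cs; rewrite divn_small.
move=> a ac ad; rewrite divn_small // addn0 in le.
have v0 := relaxed_layer0 own0 rel curM.
rewrite v0 addn0 in le.
have [n0|np] := posnP n.
  by rewrite (_ : marked n mark = 0) // /marked n0.
(* [maxn] only affects the labels with the inexistent disk 0. *)
pose disc (l : 'I_n.+1 * 'I_n.+1) := maxn 1 l.2.
have disc_ok l : 0 < disc l <= n by rewrite /disc leq_max /= geq_max np -ltnS ltn_ord.
have a_cov (i : 'I_n) : cov i.+1 (disc (a i)).
  by rewrite /disc (maxn_idPr _) //; case: (cov_bound _ _ (ac i)) => /andP[].
(* The trace ended in layer 0, so the number of marks is at most [n - val (n * M)], which [top]
   bounds by the number of labels. *)
have top := val_top disc_ok a_cov ad (relaxed_skip own_gt0 rel) (relaxed_use own_gt0 rel)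
  (relaxed_drop own0 own_gt0 rel) (relaxed_buy rel).
by lia.
Qed.

End Correctness.

Lemma size_kept_marked (R : realType) (s : seq (R * R)) mark n :
  size (kept s mark n) = marked n mark.
Proof. by rewrite size_map size_filter /marked (iotaDl 1 0) count_map. Qed.

Lemma mem_kept (R : realType) (s : seq (R * R)) mark n v :
  (0 < v <= n)%N -> (0 < mark v)%N -> point s v \in kept s mark n.
Proof.
case: v => // v /= vn m; apply/mapP; exists v => //.
by rewrite mem_filter m mem_iota.
Qed.

Lemma kept_sub (R : realType) (s : seq (R * R)) mark : {subset kept s mark (size s) <= s}.
Proof.
move=> p /mapP[t]; rewrite mem_filter mem_iota => /andP[_ /= tn] ->.
exact: mem_nth.
Qed.

Lemma kept_uniq (R : realType) (s : seq (R * R)) mark : uniq s -> uniq (kept s mark (size s)).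
Proof.
move=> us; rewrite map_inj_in_uniq ?filter_uniq ?iota_uniq // => i j.
rewrite !mem_filter !mem_iota => /andP[_ /= i_n] /andP[_ /= j_n] /eqP.
by rewrite nth_uniq // => /eqP.
Qed.

Local Open Scope fset_scope.
Local Open Scope ring_scope.

(** [n.+1 <= 2 * n] accounts for the factor [2 ^+ 6], and [ln 2 <= ln n] for the division by
    [ln 2]. *)
Lemma time_bound (R : realType) (K n t : nat) : (2 <= n)%N ->
  (t <= K * n.+1 ^ 6)%N ->
  t%:R <= K%:R * 2 ^+ 6 / ln 2 * (n%:R ^+ 6 * ln n%:R) :> R.
Proof.
move=> n2 le.
have l2 : 0 < ln 2 :> R by rewrite ln_gt0 // ltr1n.
have ln2 : ln 2 <= ln n%:R :> R by rewrite ler_ln ?posrE ?ltr0n ?ler_nat //; lia.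
have le2 : (t <= K * (2 * n) ^ 6)%N.
  by apply: leq_trans le _; rewrite leq_mul2l leq_exp2r //; apply/orP; right; lia.
have le3 : t%:R <= K%:R * 2 ^+ 6 * n%:R ^+ 6 :> R.
  by rewrite -mulrA -exprMn -natrM -natrX -natrM ler_nat.
have c0 : 0 <= K%:R * 2 ^+ 6 * n%:R ^+ 6 :> R.
  by rewrite !mulr_ge0 // exprn_ge0 ?ler0n.
apply: le_trans le3 _; rewrite [X in _ <= X]mulrACA ler_peMr //.
by rewrite mulrC ler_pdivlMr // mul1r.
Qed.

Theorem theorem1 (R : realType) :
  exists (P : cmd) (k : nat) (C : R) (n0 : nat),
    forall (n : nat) (S : {fset R * R}) (s : seq (R * R)),
      #|` S| = n -> uniq s -> s =i S ->
      exists (t : nat) (st : state R) (S' : {fset R * R}),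
        [/\ exec (word_size k n) P (input s) t st,
            uniq (output st) /\ output st =i S',
            dominating S S',
            forall OPT : {fset R * R}, min_dominating S OPT ->
              (#|` S'| <= 4 * #|` OPT|)%N
          & (n0 <= n)%N -> t%:R <= C * (n%:R ^+ 6 * ln n%:R)].
Proof.
exists program, 7%N, ((30 * 1000)%N%:R * 2 ^+ 6 / ln 2), 2%N => n S s cS us sS.
have ss : size s = n by rewrite -cS; apply/perm_size/uniq_perm; rewrite ?fset_uniq.
have [t [st [ex le [own [bs [mark [rs out dom opt]]]]]]] := program_correct ss.
have uo : uniq (kept s mark n) by rewrite -ss kept_uniq.
pose S' := [fset p in kept s mark n].
have memS' : output st =i S' by move=> p; rewrite out inE.
have cS' : #|` S'| = marked n mark.
  rewrite -(size_kept_marked s); apply/perm_size/uniq_perm => // p.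
  by rewrite -memS' out.
have ptP p : p \in S -> exists2 v, (0 < v <= n)%N & p = point s v.
  rewrite -sS => ps; exists (index p s).+1; first by rewrite /= -ss index_mem.
  by rewrite /point /= nth_index.
exists t, st, S'; split=> //; [by split; rewrite ?out // -out| |move=> OPT [[sub domO] _]|move=> n2; exact: time_bound n2 le].
  split; first by apply/fsubsetP => p; rewrite -memS' out -sS -ss => /kept_sub.
  move=> p /ptP[v vn ->]; have [j jn oj] := own_onto rs vn.
  have [u u0 /and3P[_ un]] := dom j jn; rewrite oj => d.
  by exists (point s u) => //; rewrite -memS' out mem_kept.
(* Numbers 0 and 1 denote the same point under [point s], so 0 is excluded to keep the map
   injective. *)
pose D := [set v : 'I_n.+1 | (0 < v)%N && (point s v \in OPT)].
have ord_lt (v : 'I_n.+1) : (0 < v)%N -> (v.-1 < size s)%N.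
  by move=> v0; rewrite ss prednK // -ltnS.
have cD : (#|D| <= #|` OPT|)%N.
  rewrite cardE -(size_map (fun v : 'I_n.+1 => point s v)); apply: uniq_leq_size.
    rewrite map_inj_in_uniq ?enum_uniq // => u v; rewrite !mem_enum !inE.
    move=> /andP[u0 _] /andP[v0 _] /eqP; rewrite /point nth_uniq ?ord_lt // => /eqP e.
    by apply: val_inj; rewrite /= -(prednK u0) e prednK.
  by move=> p /mapP[v]; rewrite mem_enum inE => /andP[_ h] ->.
have domD j : (0 < j <= n)%N -> exists2 v, v \in D & covers n own (point s) j v.
  move=> jn; have on := own_range rs jn; have /andP[o0 o1] := on.
  have pS : point s (own j) \in S by rewrite -sS mem_nth // ss; lia.
  have [q qO d] := domO _ pS.
  have [v vn qv] := ptP q (fsubsetP sub _ qO).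
  have vn1 : (v < n.+1)%N by lia.
  exists (Ordinal vn1); first by rewrite inE /= -qv qO andbT; case/andP: vn.
  by rewrite /covers /= o0 vn -qv.
have [a [oka la da]] := row_assignment rs domD.
rewrite cS' (leq_trans (opt a _ da)) //; first by move=> i; case: (oka i).
by rewrite (leq_trans la) // leq_mul2l cD orbT.
Qed.
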